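(* A smooth unit vector field $\sigma$ on the unit sphere $S^3$ (standard metric) is a shear-free geodesic congruence if and only if $\sigma$ is a Hopf vector field.
   Context: A vector field $X$ on a Riemannian manifold $(M,g)$ is a shear-free congruence (defines a conformal foliation) if there is a smooth function $\lambda:M\to\mathbb{R}$ with $(L_Xg)(A,B)=\lambda\,g(A,B)$ for all vector fields $A,B$ pointwise orthogonal to $X$, where $L_X$ is the Lie derivative. It is a shear-free geodesic congruence if in addition its integral curves are (possibly reparametrized) geodesics. The canonical Hopf vector field on $S^3\subset\mathbb{C}^2$ is $x\mapsto ix$; a Hopf vector field is any unit vector field congruent to it, i.e. its image under an isometry of $S^3$ (element of $O(4)$). *)

(* Defs.v *)
From HB Require Import structures.
From mathcomp Require Import all_boot all_order all_algebra.
From mathcomp Require Import all_classical all_reals all_analysis.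
Set Implicit Arguments.
Unset Strict Implicit.
Unset Printing Implicit Defensive.
Import Order.TTheory GRing.Theory Num.Theory.
Import numFieldNormedType.Exports.
Local Open Scope classical_set_scope.
Local Open Scope ring_scope.

Section Smooth.
Variables (R : realType) (V W : normedModType R).

(* C^k on an open subset U of a finite-dimensional V. *)
Fixpoint Ck_on (k : nat) (U : set V) (f : V -> W) : Prop :=
  match k with
  | 0 => forall x, U x -> {for x, continuous f}
  | k'.+1 => (forall x, U x -> differentiable f x) /\
             (forall v : V, Ck_on k' U (fun x => 'D_v f x))
  end.

Definition smooth_on (U : set V) (f : V -> W) : Prop :=
  forall k, Ck_on k U f.

(* Smoothness of a map on an arbitrary subset S: local smooth extensions.
   Only the values of f on S matter. *)
Definition smooth_on_subset (S : set V) (f : V -> W) : Prop :=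
  forall x, S x -> exists U : set V, exists F : V -> W,
    [/\ open U, U x, smooth_on U F & forall y, U y -> S y -> F y = f y].

End Smooth.

Section Sphere.
Variable R : realType.

(* The entries of a row vector (x0, x1, x2, x3) are the real coordinates of
   (x0 + i x1, x2 + i x3) in C^2.  The library norm on 'rV[R]_4 is the sup norm
   (same topology), so the Euclidean structure is defined by hand. *)
Local Notation E := 'rV[R]_4.

Definition dot (u v : E) : R := \sum_(i < 4) u ord0 i * v ord0 i.

Definition S3 : set E := [set x | dot x x = 1].

(* Maps and vector fields on the sphere are represented by maps on E of which
   only the values on S3 are relevant. *)
Definition smooth_on_S3 (W : normedModType R) (f : E -> W) : Prop :=
  smooth_on_subset S3 f.

Definition vector_field (X : E -> E) : Prop :=
  smooth_on_S3 X /\ forall x, S3 x -> dot (X x) x = 0.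

Definition unit_vector_field (X : E -> E) : Prop :=
  vector_field X /\ forall x, S3 x -> dot (X x) (X x) = 1.

Definition radial_proj (x : E) : E := (Num.sqrt (dot x x))^-1 *: x.

(* The differential at x in S3 of a map f on S3, applied to a vector v tangent
   to S3 at x: the derivative at t = 0 of f along the curve
   (x + t v) / |x + t v| of S3, whose velocity at t = 0 is v. *)
Definition dS3 (W : normedModType R) (f : E -> W) (x v : E) : W :=
  'D_v (f \o radial_proj) x.

(* The bracket is characterised by [X, A] h = X (A h) - A (X h); taking for h
   the coordinate functions of E gives this formula. *)
Definition lie_bracket (X A : E -> E) (x : E) : E :=
  dS3 A x (X x) - dS3 X x (A x).

(* (L_X g)(A, B) = X (g (A, B)) - g ([X, A], B) - g (A, [X, B]), where g is the
   metric induced on S3 by dot. *)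
Definition lie_metric (X A B : E -> E) (x : E) : R :=
  dS3 (W := R^o) (fun y => dot (A y) (B y)) x (X x)
  - dot (lie_bracket X A x) (B x) - dot (A x) (lie_bracket X B x).

Definition orthogonal_fields (X A : E -> E) : Prop :=
  forall x, S3 x -> dot (X x) (A x) = 0.

Definition shear_free (X : E -> E) : Prop :=
  exists lambda : E -> R,
    smooth_on_S3 (W := R^o) lambda /\
    forall A B : E -> E, vector_field A -> vector_field B ->
      orthogonal_fields X A -> orthogonal_fields X B ->
      forall x, S3 x -> lie_metric X A B x = lambda x * dot (A x) (B x).

Definition open_interval (I : set R) : Prop := open I /\ is_interval I.

Definition integral_curve (X : E -> E) (I : set R) (c : R -> E) : Prop :=
  forall t, I t -> S3 (c t) /\ is_derive (t : R^o) 1 c (X (c t)).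

(* The Levi-Civita covariant derivative of S3 along a curve is the ordinary
   derivative followed by orthogonal projection to the tangent space. *)
Definition tangent_proj (x v : E) : E := v - dot v x *: x.

Definition geodesic (J : set R) (c : R -> E) : Prop :=
  smooth_on (V := R^o) J c /\
  forall t, J t -> S3 (c t) /\ tangent_proj (c t) (derive1n 2 c t) = 0.

(* c on I becomes a geodesic after composition with a diffeomorphism phi from
   an open interval J onto I. *)
Definition reparametrized_geodesic (I : set R) (c : R -> E) : Prop :=
  exists J : set R, exists phi : R -> R,
    [/\ open_interval J,
        smooth_on (V := R^o) (W := R^o) J phi,
        forall s, J s -> derive1 phi s != 0,
        phi @` J = I &
        geodesic J (c \o phi)].

Definition shear_free_geodesic (X : E -> E) : Prop :=
  shear_free X /\
  forall (I : set R) (c : R -> E), open_interval I ->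
    integral_curve X I c -> reparametrized_geodesic I c.

(* x |-> i x on C^2. *)
Definition canonical_hopf (x : E) : E :=
  \row_(j < 4) [:: - x ord0 (inord 1); x ord0 (inord 0);
                   - x ord0 (inord 3); x ord0 (inord 2)]`_j.

(* Image of X under the isometry x |-> x *m Q of S3, for Q in O(4). *)
Definition pushforward (Q : 'M[R]_4) (X : E -> E) (y : E) : E :=
  X (y *m invmx Q) *m Q.

Definition hopf_vector_field (X : E -> E) : Prop :=
  unit_vector_field X /\
  exists Q : 'M[R]_4, Q *m Q^T = 1%:M /\
    forall y, S3 y -> X y = pushforward Q canonical_hopf y.

End Sphere.

(* Main.v *)
(** Identify a unit field with its degree-0 homogeneous extension [s], and let
    [x, s x, w1, w2] be a positive orthonormal frame at a point [x] of the sphere.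
    The geodesic condition, tested on integral curves (Picard-Lindelof), gives
    [ds (s x) = - x]; hence (Gronwall) the leaves are great circles.  Shear-freeness
    says that [ds] acts on the normal plane as [a + b J], [J] being the rotation by a
    right angle.

    Fix a leaf through [x0] and let [p] and [q] be the inner products of the
    self-dual and of the anti-self-dual parts of [x /\ s x] and [x0 /\ s x0].  Then
    [p - q = 2 det (x, s x, x0, s x0)] vanishes only on the fixed leaf, since distinct
    great circles that are leaves are disjoint; its sign is constant off that leaf
    (after a change of orientation, [q < p]), and agrees with the sign of [b].
    The Codazzi equation gives [Lap p = -2 k p], [|grad p|^2 = k (1 - p^2)],
    [Lap q = -2 m q] and [|grad q|^2 = m (1 - q^2)], where [k = a^2 + (b - 1)^2] and
    [m = a^2 + (b + 1)^2].  Thus [H := (1 - p)^2 / ((1 + p)^2 (1 - q))] satisfies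
    [Lap (log H) = m > 0] wherever [H > 0]; as [H] tends to 0 along the fixed leaf, it
    has a maximum, which can only be 0.  So [p = 1] everywhere, which means that the
    field is [x |-> x *m L] for an orthogonal antisymmetric matrix [L]. *)
From HB Require Import structures.
Require Import Defs.
From mathcomp Require Import all_boot all_order all_algebra.
From mathcomp Require Import all_classical all_reals all_analysis.
From mathcomp Require Import ring lra.
Set Implicit Arguments.
Unset Strict Implicit.
Unset Printing Implicit Defensive.
Import Order.TTheory GRing.Theory Num.Theory.
Import numFieldNormedType.Exports.
Local Open Scope classical_set_scope.
Local Open Scope ring_scope.

(** * The Euclidean structure *)

(** The self-dual and anti-self-dual parts of [x /\ s x] give a map into S^2 x S^2, and the field is
    Hopf exactly when one component is constant; this is why [p = 1] is the goal. By the stated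
    equations [log (1 - p)] and [log (1 + p)] both have Laplacian [- k], and [log (1 - q)] has
    Laplacian [- m]. Hence [log ((1 - p) / (1 + p))] is harmonic where defined, whatever [k] is, and
    the factor [1 / (1 - q)] supplies the strict sign. Any power of the harmonic factor would keep
    the Laplacian; the exponent 2 is chosen because [q <= p] gives [(1 - p)^2 / (1 - q) <= 1 - q],
    which tends to 0 at the fixed leaf, where [p = q = 1], while the first power would only stay
    bounded. The sign of [b] enters through [m = 1 + a^2 + b^2 + 2 b]. Since [x /\ s x] is constant
    along leaves, so are [p] and [q], and their Laplacians involve the two normal directions only.
    The change of orientation is carried by a sign [e] in the duality, not by a reflection of the
    sphere. *)

Section Euclidean.
Variable R : realType.
Local Notation E := 'rV[R]_4.
Implicit Types x y z : E.

Lemma dotC x y : dot x y = dot y x.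
Proof. by apply: eq_bigr => i _; rewrite mulrC. Qed.

Lemma dotDl x y z : dot (x + y) z = dot x z + dot y z.
Proof.
by rewrite /dot -big_split; apply: eq_bigr => i _; rewrite mxE mulrDl.
Qed.

Lemma dotZl a x y : dot (a *: x) y = a * dot x y.
Proof. by rewrite /dot mulr_sumr; apply: eq_bigr => i _; rewrite mxE mulrA. Qed.

Lemma dotDr x y z : dot z (x + y) = dot z x + dot z y.
Proof. by rewrite dotC dotDl !(dotC z). Qed.

Lemma dotZr a x y : dot x (a *: y) = a * dot x y.
Proof. by rewrite dotC dotZl dotC. Qed.

Lemma dotNl x y : dot (- x) y = - dot x y.
Proof. by rewrite -scaleN1r dotZl mulN1r. Qed.

Lemma dotNr x y : dot x (- y) = - dot x y.
Proof. by rewrite dotC dotNl dotC. Qed.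

Lemma dotBl x y z : dot (x - y) z = dot x z - dot y z.
Proof. by rewrite dotDl dotNl. Qed.

Lemma dotBr x y z : dot z (x - y) = dot z x - dot z y.
Proof. by rewrite dotDr dotNr. Qed.

Lemma dot0l x : dot 0 x = 0.
Proof. by rewrite -(scale0r 0) dotZl mul0r. Qed.

Lemma dot0r x : dot x 0 = 0.
Proof. by rewrite dotC dot0l. Qed.

Lemma dot_ge0 x : 0 <= dot x x.
Proof. by apply: sumr_ge0 => i _; rewrite -expr2 sqr_ge0. Qed.

Lemma dot_eq0 x : (dot x x == 0) = (x == 0).
Proof.
apply/idP/eqP => [|->]; last by rewrite dot0l.
rewrite psumr_eq0 => [/allP x0|i _]; last by rewrite -expr2 sqr_ge0.
apply/rowP => i; rewrite mxE; apply/eqP.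
by have := x0 i (mem_index_enum _); rewrite /= mulf_eq0 orbb.
Qed.

Lemma dot_gt0 x : (0 < dot x x) = (x != 0).
Proof. by rewrite lt_neqAle dot_ge0 andbT eq_sym dot_eq0. Qed.

Lemma dot_delta x k : dot x (delta_mx ord0 k) = x ord0 k.
Proof.
rewrite /dot (bigD1 k)//= mxE !eqxx mulr1 big1 ?addr0// => i ik.
by rewrite mxE (negbTE ik) andbF mulr0.
Qed.

Lemma dot_ext x y : (forall z, dot x z = dot y z) -> x = y.
Proof. by move=> xy; apply/rowP => k; rewrite -!dot_delta xy. Qed.

Lemma dot_mulmx x y (L : 'M[R]_4) : dot (x *m L) y = dot x (y *m L^T).
Proof.
rewrite /dot; under eq_bigr do rewrite mxE mulr_suml.
rewrite exchange_big; apply: eq_bigr => i _; rewrite mxE mulr_sumr.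
by apply: eq_bigr => j _; rewrite !mxE mulrAC mulrA.
Qed.

Lemma S3_neq0 x : S3 x -> x != 0.
Proof. by move=> xS; rewrite -dot_gt0 xS. Qed.

Lemma radial_proj_S3 x : x != 0 -> S3 (radial_proj x).
Proof.
rewrite -dot_gt0 => x0; rewrite /S3/= /radial_proj dotZl dotZr mulrA -invfM.
by rewrite -expr2 sqr_sqrtr ?ltW// mulVf// gt_eqF.
Qed.

Lemma radial_proj_id x : S3 x -> radial_proj x = x.
Proof. by rewrite /S3/= /radial_proj => ->; rewrite sqrtr1 invr1 scale1r. Qed.

Lemma radial_projZ a x : 0 < a -> radial_proj (a *: x) = radial_proj x.
Proof.
move=> a0; rewrite /radial_proj dotZl dotZr mulrA -expr2.
rewrite sqrtrM ?sqr_ge0// sqrtr_sqr gtr0_norm// invfM scalerA mulrAC.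
by rewrite mulVf ?mul1r ?gt_eqF.
Qed.

End Euclidean.

(** * Calculus of row-vector-valued maps *)

Section PointwiseRules.
Variables (R : realType) (V W : normedModType R).

Lemma is_derive_mul (f g : V -> R) x v (df dg : R) :
  is_derive x v f df -> is_derive x v g dg ->
  is_derive x v (fun y => f y * g y) (df * g x + f x * dg).
Proof.
move=> hf hg; have := @is_deriveM _ _ _ _ _ _ _ _ hf hg.
by rewrite addrC -[g x *: df]mulrC.
Qed.

Lemma is_derive_add (f g : V -> W) x v df dg :
  is_derive x v f df -> is_derive x v g dg ->
  is_derive x v (fun y => f y + g y) (df + dg).
Proof. by move=> hf hg; exact: is_deriveD. Qed.

Lemma is_derive_sub (f g : V -> W) x v df dg :
  is_derive x v f df -> is_derive x v g dg ->
  is_derive x v (fun y => f y - g y) (df - dg).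
Proof. by move=> hf hg; exact: is_deriveB. Qed.

Lemma is_derive_opp (f : V -> W) x v df :
  is_derive x v f df -> is_derive x v (fun y => - f y) (- df).
Proof. by move=> hf; exact: is_deriveN. Qed.

Lemma is_derive_const (a : W) (x v : V) : is_derive x v (fun=> a) 0.
Proof. exact: is_derive_cst. Qed.

Lemma is_derive_bigsum n (f : 'I_n -> V -> W) x v (df : 'I_n -> W) :
  (forall i, is_derive x v (f i) (df i)) ->
  is_derive x v (fun y => \sum_i f i y) (\sum_i df i).
Proof.
move=> H; have := @is_derive_sum _ _ _ _ f x v df H.
by have -> : \sum_i f i = (fun y => \sum_i f i y)
  by rewrite funeqE => y; rewrite fct_sumE.
Qed.

Lemma differentiable_mul (f g : V -> R) x :
  differentiable f x -> differentiable g x ->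
  differentiable (fun y => f y * g y) x.
Proof. by move=> hf hg; exact: differentiableM. Qed.

Lemma differentiable_bigsum n (f : 'I_n -> V -> W) x :
  (forall i, differentiable (f i) x) ->
  differentiable (fun y => \sum_i f i y) x.
Proof.
move=> H; have -> : (fun y => \sum_i f i y) = \sum_i f i.
  by rewrite funeqE => y; rewrite fct_sumE.
exact: differentiable_sum.
Qed.

End PointwiseRules.

Section RowCalculus.
Variables (R : realType) (V : normedModType R).
Local Notation E := 'rV[R]_4.
Implicit Types (c f g : V -> E) (x v : V).

Lemma row_sum (u : E) : u = \sum_k u ord0 k *: delta_mx ord0 k.
Proof. exact: row_sum_delta. Qed.

Lemma is_derive_rV c x v (d : E) :
  is_derive x v c d <-> (forall k, is_derive x v (fun y => c y ord0 k) (d ord0 k)).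
Proof.
split=> [[dc cd] k|H].
  have /derivable_mxP dck := dc; split; first exact: dck.
  by rewrite -cd derive_mx// mxE.
have dc : derivable c x v.
  by apply/derivable_mxP => i j; rewrite (ord1 i); case: (H j).
split=> //; rewrite derive_mx//; apply/rowP => k; rewrite mxE.
by case: (H k).
Qed.

Lemma differentiable_rV c x :
  differentiable c x <-> (forall k, differentiable (fun y => c y ord0 k : R) x).
Proof.
split=> [dc k|dc].
  apply: (@differentiable_comp _ _ _ _ c (fun u : E => u ord0 k : R)) => //.
  exact: differentiable_coord.
have -> : c = \sum_k (fun y => c y ord0 k *: (delta_mx ord0 k : E)).
  by rewrite funeqE => y; rewrite fct_sumE -row_sum.
by apply: differentiable_sum => k; exact: differentiableZl.
Qed.

Lemma is_derive_dot c1 c2 x v (d1 d2 : E) :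
  is_derive x v c1 d1 -> is_derive x v c2 d2 ->
  is_derive x v (fun y => dot (c1 y) (c2 y)) (dot d1 (c2 x) + dot (c1 x) d2).
Proof.
move=> /is_derive_rV h1 /is_derive_rV h2.
apply: (is_derive_eq (is_derive_bigsum (fun i => is_derive_mul (h1 i) (h2 i)))).
by rewrite /dot -big_split.
Qed.

Lemma differentiable_dot c1 c2 x :
  differentiable c1 x -> differentiable c2 x ->
  differentiable (fun y => dot (c1 y) (c2 y) : R) x.
Proof.
move=> /differentiable_rV h1 /differentiable_rV h2.
by apply: differentiable_bigsum => i; exact: differentiable_mul.
Qed.

Lemma is_derive_mulmx c x v (d : E) (L : 'M[R]_4) :
  is_derive x v c d -> is_derive x v (fun y => c y *m L) (d *m L).
Proof.
move=> /is_derive_rV h; apply/is_derive_rV => k.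
under eq_fun do rewrite mxE.
apply: (is_derive_eq (is_derive_bigsum (fun i =>
  is_derive_mul (h i) (is_derive_const (L i k) x v)))).
by rewrite mxE; apply: eq_bigr => i _; rewrite mulr0 addr0.
Qed.

Lemma differentiable_mulmx c x (L : 'M[R]_4) :
  differentiable c x -> differentiable (fun y => c y *m L) x.
Proof.
move=> /differentiable_rV h; apply/differentiable_rV => k.
under eq_fun do rewrite mxE.
by apply: differentiable_bigsum => i; apply: differentiable_mul.
Qed.

Lemma is_derive_scale (a : V -> R) c x v (da : R) (d : E) :
  is_derive x v a da -> is_derive x v c d ->
  is_derive x v (fun y => a y *: c y) (da *: c x + a x *: d).
Proof.
move=> ha /is_derive_rV h; apply/is_derive_rV => k.
under eq_fun do rewrite mxE.
by apply: (is_derive_eq (is_derive_mul ha (h k))); rewrite !mxE.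
Qed.

Lemma differentiable_scale (a : V -> R) c x :
  differentiable a x -> differentiable c x ->
  differentiable (fun y => a y *: c y) x.
Proof.
move=> ha /differentiable_rV h; apply/differentiable_rV => k.
under eq_fun do rewrite mxE.
exact: differentiable_mul.
Qed.

End RowCalculus.

Section Chain.
Variables (R : realType) (V W : normedModType R).

Lemma is_derive_differentiable (c : R -> V) (t : R) d :
  is_derive t 1 c d -> differentiable c t.
Proof. by case=> dc _; apply/derivable1_diffP. Qed.

Lemma is_derive_chain (F : V -> W) (c : R -> V) (t : R) d :
  differentiable F (c t) -> is_derive t 1 c d ->
  is_derive t 1 (F \o c) ('d F (c t) d).
Proof.
move=> dF hc; have dc := is_derive_differentiable hc.
have dFc : differentiable (F \o c) t by exact: differentiable_comp.
split; first exact/derivable1_diffP.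
have E : 'd c t 1 = d by rewrite -deriveE//; exact: derive_val.
by rewrite deriveE// diff_comp//= E.
Qed.

Lemma derive_compE (U : normedModType R) (F : V -> W) (c : U -> V) y v :
  differentiable c y -> differentiable F (c y) ->
  'D_v (F \o c) y = 'd F (c y) ('D_v c y).
Proof.
move=> dc dF; rewrite deriveE; last exact: differentiable_comp.
by rewrite diff_comp//= deriveE.
Qed.

(** Differentiability depends only on the germ; this carries it from a local extension of the field
    to the homogeneous one. *)
Lemma near_eq_differentiable (f g : V -> W) x :
  (\near x, f x = g x) -> differentiable f x -> differentiable g x.
Proof.
move=> fg df.
have fgx : f x = g x := nbhs_singleton fg.
apply/diff_locallyP.
suff E : 'd g x = 'd f x :> (V -> W) /\ g \o shift x = cst (g x) + 'd f x +o_ (nbhs (0:V)) id.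
  case: E => -> E; split => //; exact: diff_continuous.
have key : g \o shift x = cst (g x) + 'd f x +o_ (nbhs (0:V)) id.
  have /eqaddoP H := diff_locally df.
  apply/eqaddoP => e e0; have := H e e0; move=> He.
  have fg0 : \forall h \near (0:V), f (h + x) = g (h + x).
    have C : (fun h : V => h + x) @ (0 : V) --> x.
      rewrite -[X in _ --> X]add0r.
      by apply: cvgD; [exact: cvg_id | exact: cvg_cst].
    exact: (C _ fg).
  apply: filterS2 He fg0 => h He fgh.
  suff -> : (g \o shift x - (cst (g x) + 'd f x)) h =
            (f \o shift x - (cst (f x) + 'd f x)) h by [].
  by change (g (h + x) - (g x + 'd f x h) = f (h + x) - (f x + 'd f x h));
    rewrite fgx fgh.
split=> //; apply: diff_unique => //; exact: diff_continuous.
Qed.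

End Chain.

(** * Maps of class C^k and homogeneous extensions *)

Section CkRules.
Variables (R : realType) (V W : normedModType R).
Implicit Types (U : set V) (f g : V -> W).

Lemma Ck_on_ext k U f g : open U -> (forall x, U x -> f x = g x) ->
  Ck_on k U f -> Ck_on k U g.
Proof.
move=> oU; elim: k f g => [|k IH] f g fg /=.
  move=> cf x Ux; have nfg : \forall y \near x, f y = g y.
    by apply: filterS (open_nbhs_nbhs (conj oU Ux)).
  have := cf x Ux; rewrite /prop_for /continuous_at -fg// => cfx.
  apply: cvg_trans cfx; exact: near_eq_cvg.
have nfg x : U x -> \forall y \near x, f y = g y.
  by move=> Ux; apply: filterS (open_nbhs_nbhs (conj oU Ux)).
case=> df Ckf; split=> [x Ux|v].
  exact: near_eq_differentiable (nfg x Ux) (df x Ux).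
apply: IH (Ckf v) => x Ux; exact/near_eq_derive/nfg.
Qed.

Lemma Ck_on_pred k U f : Ck_on k.+1 U f -> Ck_on k U f.
Proof.
elim: k f => [|k IH] f [df Ckf].
  by move=> x /df /differentiable_continuous.
by split=> // v; exact: IH.
Qed.

Lemma Ck_on_cst k U (a : W) : Ck_on k U (fun=> a).
Proof.
elim: k a => [|k IH] a /=; first by move=> x _; exact: cst_continuous.
split=> [//|v]; suff -> : (fun x => 'D_v (fun=> a) x) = (fun=> 0 : W) by [].
by rewrite funeqE => x; rewrite derive_cst.
Qed.

Lemma Ck_on_add k U f g : open U ->
  Ck_on k U f -> Ck_on k U g -> Ck_on k U (fun x => f x + g x).
Proof.
move=> oU; elim: k f g => [|k IH] f g /=.
  by move=> cf cg x Ux; apply: cvgD; [exact: cf | exact: cg].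
move=> [df Cf] [dg Cg]; split=> [x Ux|v].
  by apply: differentiableD; [exact: df | exact: dg].
apply: (Ck_on_ext oU _ (IH _ _ (Cf v) (Cg v))) => x Ux.
have hf := derivableP (diff_derivable (v := v) (df x Ux)).
have hg := derivableP (diff_derivable (v := v) (dg x Ux)).
by have [_ ->] := is_derive_add hf hg.
Qed.

End CkRules.

Section CkRow.
Variables (R : realType) (V : normedModType R).
Local Notation E := 'rV[R]_4.

Lemma Ck_on_id k (U : set V) : Ck_on k U id.
Proof.
case: k => [|k] /=; first by move=> x _; exact: cvg_id.
split=> [//|v].
have -> : (fun x => 'D_v id x) = (fun=> v : V).
  by rewrite funeqE => x; rewrite derive_id.
exact: Ck_on_cst.
Qed.

Lemma Ck_on_dot_cst k (U : set V) (a : E) (f : V -> E) : open U ->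
  Ck_on k U f -> Ck_on k U (fun x => dot a (f x) : R^o).
Proof.
move=> oU; elim: k f => [|k IH] f /=.
  move=> cf x Ux.
  apply: (@continuous_comp _ _ _ f (fun u : E => dot a u : R)); first exact: cf.
  apply: differentiable_continuous.
  by apply: differentiable_dot.
move=> [df Cf]; split=> [x Ux|v].
  by apply: differentiable_dot; [exact: differentiable_cst | exact: df].
apply: (Ck_on_ext oU _ (IH _ (Cf v))) => x Ux.
have := is_derive_dot (is_derive_const a x v) (derivableP (diff_derivable (v := v) (df x Ux))).
by case=> _ ->; rewrite dot0l add0r.
Qed.

Lemma Ck_on_scale k (U : set V) (a : V -> R^o) (f : V -> E) : open U ->
  Ck_on k U a -> Ck_on k U f -> Ck_on k U (fun x => (a x : R) *: f x).
Proof.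
move=> oU; elim: k a f => [|k IH] a f /=.
  by move=> cf cg x Ux; apply: cvgZ; [exact: cf | exact: cg].
move=> Ca Cf; have [da Ca'] := Ca; have [df Cf'] := Cf; split=> [x Ux|v].
  by apply: differentiable_scale; [exact: da | exact: df].
have H1 := IH _ _ (Ca' v) (Ck_on_pred Cf).
have H2 := IH _ _ (Ck_on_pred Ca) (Cf' v).
apply: (Ck_on_ext oU _ (Ck_on_add oU H1 H2)) => x Ux.
have := is_derive_scale (derivableP (diff_derivable (v := v) (da x Ux)))
  (derivableP (diff_derivable (v := v) (df x Ux))).
by case=> _ ->.
Qed.

End CkRow.

Section Radial.
Variable R : realType.
Local Notation E := 'rV[R]_4.
Implicit Types (x y z v : E).

Definition inv_norm (y : E) : R := (Num.sqrt (dot y y))^-1.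

Lemma near_neq0 y : y != 0 -> \forall z \near y, z != 0.
Proof.
move=> y0; have c : id @ y --> y by exact: cvg_id.
exact: (cvgr_neq0 _ c y0).
Qed.

Lemma differentiable_inv_norm y : y != 0 -> differentiable inv_norm y.
Proof.
rewrite -dot_gt0 => y0.
apply: (@differentiable_comp _ _ _ _ (fun z => dot z z : R)
  (fun r : R => (Num.sqrt r)^-1)).
  by apply: differentiable_dot.
apply: differentiableV; last by rewrite sqrtr_eq0 -ltNge.
by apply/derivable1_diffP; case: (is_derive1_sqrt y0).
Qed.

Lemma inv_normM y : y != 0 -> inv_norm y ^+ 2 * dot y y = 1.
Proof.
move=> y0; have d0 : 0 < dot y y by rewrite dot_gt0.
by rewrite /inv_norm exprVn sqr_sqrtr ?ltW// mulVf// gt_eqF.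
Qed.

Lemma inv_norm_gt0 y : y != 0 -> 0 < inv_norm y.
Proof. by rewrite -dot_gt0 => y0; rewrite /inv_norm invr_gt0 sqrtr_gt0. Qed.

(** Obtained by differentiating the constant product in [inv_normM], so that the derivative of the
    square root is never computed. *)
Lemma is_derive_inv_norm y v : y != 0 ->
  is_derive y v inv_norm (- (inv_norm y ^+ 3 * dot y v)).
Proof.
move=> y0; have dn := derivableP (diff_derivable (v := v) (differentiable_inv_norm y0)).
apply: is_derive_eq; set d := 'D_v inv_norm y in dn *.
have hid := is_derive_id y v.
have H := is_derive_mul (is_derive_mul dn dn) (is_derive_dot hid hid).
have [_] := H; rewrite -(@near_eq_derive _ _ _ (cst (1 : R))); last first.
  by near=> z; rewrite /= -expr2 inv_normM//; near: z; exact: near_neq0.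
rewrite derive_cst (dotC v) => H1.
have n0 := inv_norm_gt0 y0; have nM := inv_normM y0.
apply: (mulfI (lt0r_neq0 n0)); apply: (mulfI (_ : dot y y != 0)); first by rewrite dot_eq0.
have -> : dot y y * (inv_norm y * - (inv_norm y ^+ 3 * dot y v)) =
  - ((inv_norm y ^+ 2 * dot y y) * (inv_norm y ^+ 2 * dot y v)) by ring.
by rewrite nM; move: H1 => /=; lra.
Unshelve. all: by end_near. Qed.

Lemma is_derive_radial_proj y v : y != 0 ->
  is_derive y v (@radial_proj R)
    (- (inv_norm y ^+ 3 * dot y v) *: y + inv_norm y *: v).
Proof.
move=> y0; exact: is_derive_scale (is_derive_inv_norm v y0) (is_derive_id y v).
Qed.

Lemma differentiable_radial_proj y : y != 0 -> differentiable (@radial_proj R) y.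
Proof.
move=> y0; apply: differentiable_scale => //; exact: differentiable_inv_norm.
Qed.

(** Near [y] the homogeneous extension coincides with [F \o radial_proj], where [F] is smooth on an
    open set; its regularity is read off from this replacement. *)
Lemma smooth_on_S3_local (W : normedModType R) (f : E -> W) y :
  smooth_on_S3 f -> y != 0 ->
  exists U : set E, exists F : E -> W,
   [/\ open U, smooth_on U F, U (radial_proj y) &
    \forall z \near y, U (radial_proj z) /\ f (radial_proj z) = F (radial_proj z)].
Proof.
move=> sf y0; have [U [F [oU Uy sF fF]]] := sf _ (radial_proj_S3 y0).
exists U, F; split=> //.
have nU : \forall z \near y, U (radial_proj z).
  have := differentiable_continuous (differentiable_radial_proj y0).
  by apply; exact: open_nbhs_nbhs.
near=> z; have Uz : U (radial_proj z) by near: z.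
by split=> //; rewrite fF//; apply: radial_proj_S3; near: z; exact: near_neq0.
Unshelve. all: by end_near. Qed.

Lemma differentiable_homogeneous_ext (W : normedModType R) (f : E -> W) y :
  smooth_on_S3 f -> y != 0 -> differentiable (f \o @radial_proj R) y.
Proof.
move=> sf y0; have [U [F [oU sF Uy nf]]] := smooth_on_S3_local sf y0.
apply: (@near_eq_differentiable _ _ _ (F \o @radial_proj R)).
  by apply: filterS nf => z [].
apply: differentiable_comp; first exact: differentiable_radial_proj.
by have [dF _] := sF 1%N; exact: dF.
Qed.

Lemma differentiable_derive_homogeneous_ext (f : E -> E) y v :
  smooth_on_S3 f -> y != 0 ->
  differentiable (fun z => 'D_v (f \o @radial_proj R) z) y.
Proof.
move=> sf y0; have [U [F [oU sF Uy nf]]] := smooth_on_S3_local sf y0.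
have [dF CF] := sF 2%N.
(* The coordinates of the derivative of [radial_proj] in direction [v]: the chain rule writes the
   derivative of the extension as a sum of these times partial derivatives of [F], which are
   differentiable as [F] is C^2. *)
pose a z (k : 'I_4) : R :=
  (- (inv_norm z ^+ 3 * dot z v) *: z + inv_norm z *: v) ord0 k.
apply: (@near_eq_differentiable _ _ _
   (fun z => \sum_k a z k *: 'D_(delta_mx ord0 k) F (radial_proj z))).
  have nnf := nbhs_interior nf.
  near=> z; have z0 : z != 0 by near: z; exact: near_neq0.
  have nz : nbhs z [set z | U (radial_proj z) /\
     f (radial_proj z) = F (radial_proj z)] by near: z; exact: nnf.
  have [Uz _] := nbhs_singleton nz.
  have -> : 'D_v (f \o @radial_proj R) z = 'D_v (F \o @radial_proj R) z.
    by apply: near_eq_derive; apply: filterS nz => w [].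
  have dz := differentiable_radial_proj z0.
  rewrite derive_compE//; last exact: dF.
  have -> : 'D_v (@radial_proj R) z =
      - (inv_norm z ^+ 3 * dot z v) *: z + inv_norm z *: v.
    by case: (is_derive_radial_proj v z0).
  rewrite [X in 'd F _ X]row_sum linear_sum; apply: eq_bigr => k _.
  by rewrite linearZ /= deriveE//; exact: dF.
have da k : differentiable (fun z => a z k) y.
  have /differentiable_rV : differentiable
      (fun z => - (inv_norm z ^+ 3 * dot z v) *: z + inv_norm z *: v) y; last exact.
  apply: differentiableD; apply: differentiable_scale => //;
     last exact: differentiable_inv_norm.
  apply: differentiableN; apply: differentiable_mul.
    have h := differentiable_inv_norm y0.
    exact: (differentiable_mul h (differentiable_mul h h)).
  by apply: differentiable_dot.
apply: differentiable_bigsum => k; apply: differentiable_scale => //.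
apply: (@differentiable_comp _ _ _ _ (@radial_proj R)
  (fun z => 'D_(delta_mx ord0 k) F z)).
  exact: differentiable_radial_proj.
by have [+ _] := CF (delta_mx ord0 k); apply.
Unshelve. all: by end_near. Qed.

End Radial.

(** * Symmetry of second derivatives *)

Section Schwarz.
Variables (R : realType) (V : normedModType R).

Lemma near0_radius (P : V -> Prop) : (\forall h \near (0 : V), P h) ->
  exists2 d : R, 0 < d & forall h, `|h| < d -> P h.
Proof.
move=> /nbhs_ballP[d /= d0 dP]; exists d => // h hd; apply: dP.
by rewrite -ball_normE/= sub0r normrN.
Qed.

Lemma near_radius (P : V -> Prop) x : (\forall z \near x, P z) ->
  exists2 d : R, 0 < d & forall z, `|z - x| < d -> P z.
Proof.
move=> /nbhs_ballP[d /= d0 dP]; exists d => // h hd; apply: dP.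
by rewrite -ball_normE/= distrC.
Qed.

Lemma differentiable_estimate (W : normedModType R) (G : V -> W) x e :
  differentiable G x -> 0 < e ->
  exists2 d : R, 0 < d &
    forall h, `|h| < d -> `|G (h + x) - G x - 'd G x h| <= e * `|h|.
Proof.
move=> dG e0; have /eqaddoP H := diff_locally dG.
have [d d0 dP] := near0_radius (H e e0); exists d => // h /dP.
by change ((G \o shift x - (cst (G x) + 'd G x)) h) with
  (G (h + x) - (G x + 'd G x h)); rewrite opprD addrA.
Qed.

(** Symmetric in [v] and [w]; divided by [t ^ 2] it approximates either mixed second derivative,
    which is why the two agree. *)
Definition second_diff (f : V -> R) x v w (t : R) :=
  f (t *: v + t *: w + x) - f (t *: v + x) - f (t *: w + x) + f x.

(** The mean value theorem for [r |-> f (r v + t w + x) - f (r v + x)] turns the second difference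
    into [t] times a difference of values of ['D_v f]; the first-order expansion of ['D_v f] at [x]
    then evaluates it. *)
Lemma second_diff_estimate (f : V -> R) x v w e :
  (\forall z \near x, differentiable f z) ->
  differentiable (fun z => 'D_v f z : R) x -> 0 < e ->
  exists2 d : R, 0 < d & forall t, 0 < t < d ->
    `|second_diff f x v w t - t ^+ 2 * 'D_w (fun z => 'D_v f z) x| <= e * t ^+ 2.
Proof.
move=> nf dG e0; set G := fun z => 'D_v f z : R.
pose N := `|v| + `|w| + 1.
have N0 : 0 < N by rewrite ltr_wpDl// addr_ge0.
have [d1 d10 H1] := near_radius nf.
(* Two expansion errors, each at most [e / (2 N)] times a norm bounded by [t N], add up to [e t]. *)
have e'0 : 0 < e / (2 * N) by rewrite divr_gt0// mulr_gt0.
have [d2 d20 H2] := differentiable_estimate dG e'0.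
exists (Num.min d1 d2 / N); first by rewrite divr_gt0// lt_min d10 d20.
move=> t /andP[t0 td].
have tN : t * N < Num.min d1 d2 by rewrite -ltr_pdivlMr.
have small (c b : R) : 0 <= c <= t -> 0 <= b <= t -> `|c *: v + b *: w| <= t * N.
  move=> /andP[c0 ct] /andP[b0 bt]; apply: (le_trans (ler_normD _ _)).
  rewrite !normrZ !ger0_norm// /N !mulrDr mulr1.
  have h1 := ler_wpM2r (normr_ge0 v) ct; have h2 := ler_wpM2r (normr_ge0 w) bt.
  by have := lerD h1 h2; lra.
have smallt c b : 0 <= c <= t -> 0 <= b <= t ->
    `|c *: v + b *: w| < d1 /\ `|c *: v + b *: w| < d2.
  by move=> hc hb; have := le_lt_trans (small c b hc hb) tN; rewrite lt_min => /andP.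
have t0t : 0 <= t <= t by rewrite lexx ltW.
have z0t : (0 : R) <= 0 <= t by rewrite lexx ltW.
have dfc c b : 0 <= c <= t -> 0 <= b <= t ->
    is_derive c 1 (fun r : R => f (r *: v + b *: w + x)) (G (c *: v + b *: w + x)).
  move=> hc hb.
  have df : differentiable f (c *: v + b *: w + x).
    by apply: H1; rewrite addrK; case: (smallt c b hc hb).
  rewrite /G deriveE//.
  apply: (@is_derive_chain _ _ _ f (fun r : R => r *: v + b *: w + x)) => //.
  have hv : is_derive c 1 (fun r : R => r *: v) v.
    have dl : differentiable ( *:%R^~ v : R -> V) c by [].
    split; first exact/derivable1_diffP.
    by rewrite deriveE// diff_val scale1r.
  have h := is_derive_add (is_derive_add hv (is_derive_const (b *: w) c 1)) (is_derive_const x c 1).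
  by apply: (is_derive_eq h); rewrite !addr0.
have dg c : 0 <= c <= t -> is_derive c 1
    (fun r : R => f (r *: v + t *: w + x) - f (r *: v + 0 *: w + x))
    (G (c *: v + t *: w + x) - G (c *: v + 0 *: w + x)).
  by move=> hc; apply: is_derive_sub; exact: dfc.
have itvt c : c \in `]0, t[%R -> 0 <= c <= t.
  by rewrite in_itv/= => /andP[/ltW -> /ltW ->].
have [|c cab E] := MVT t0 (fun c hc => dg c (itvt c hc)).
  apply: derivable_within_continuous => c; rewrite in_itv/= => hc.
  by case: (dg c hc).
have hc := itvt c cab.
have E2 : second_diff f x v w t =
    (G (c *: v + t *: w + x) - G (c *: v + 0 *: w + x)) * t.
  rewrite subr0 in E; rewrite -E /second_diff !scale0r !addr0 !add0r.
  by rewrite opprB; lra.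
have K1 := H2 _ (smallt c t hc t0t).2.
have K2 := H2 _ (smallt c 0 hc z0t).2.
have S1 := small c t hc t0t; have S2 := small c 0 hc z0t.
have L1 : 'd G x (c *: v + t *: w) - 'd G x (c *: v + 0 *: w) = t * 'D_w G x.
  rewrite deriveE// -linearB.
  by rewrite scale0r addr0 addrAC subrr add0r linearZ.
rewrite E2 -/G.
set A := G (c *: v + t *: w + x) in K1 *; set B := G (c *: v + 0 *: w + x) in K2 *.
set A' := 'd G x _ in K1 L1; set B' := 'd G x _ in K2 L1.
have -> : (A - B) * t - t ^+ 2 * 'D_w G x =
    ((A - G x - A') - (B - G x - B')) * t.
  have -> : t ^+ 2 * 'D_w G x = (A' - B') * t by rewrite L1; ring.
  by ring.
rewrite normrM (gtr0_norm t0) expr2 [e * _]mulrA ler_pM2r//.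
apply: (le_trans (ler_normB _ _)); apply: (le_trans (lerD K1 K2)).
rewrite -mulrDr; apply: (@le_trans _ _ (e / (2 * N) * (2 * (t * N)))).
  apply: ler_wpM2l; first exact: ltW.
  by apply: (le_trans (lerD S1 S2)); rewrite mulr_natl mulr2n.
by rewrite le_eqVlt; apply/orP; left; apply/eqP; field; rewrite gt_eqF.
Qed.

Lemma derive_comm (f : V -> R) x v w :
  (\forall z \near x, differentiable f z) ->
  differentiable (fun z => 'D_v f z : R) x ->
  differentiable (fun z => 'D_w f z : R) x ->
  'D_w (fun z => 'D_v f z) x = 'D_v (fun z => 'D_w f z) x.
Proof.
move=> nf dv dw; apply/eqP; rewrite -subr_eq0 -normr_le0.
apply/ler_addgt0Pl => e e0; rewrite addr0.
have e20 : 0 < e / 2 by rewrite divr_gt0.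
have [d1 d10 H1] := second_diff_estimate w nf dv e20.
have [d2 d20 H2] := second_diff_estimate v nf dw e20.
pose t := Num.min d1 d2 / 2.
have m0 : 0 < Num.min d1 d2 by rewrite lt_min d10 d20.
have t0 : 0 < t by rewrite divr_gt0.
have tm : t < Num.min d1 d2 by rewrite /t ltr_pdivrMr// mulr_natr mulr2n ltrDl.
have /andP[td1 td2] : (t < d1) && (t < d2) by rewrite -lt_min.
have h1 : 0 < t < d1 by rewrite t0 td1.
have h2 : 0 < t < d2 by rewrite t0 td2.
have := lerD (H1 _ h1) (H2 _ h2).
have -> : second_diff f x w v t = second_diff f x v w t.
  by rewrite /second_diff [t *: w + t *: v]addrC; ring.
set D := second_diff f x v w t; set p := 'D_w _ x; set q := 'D_v _ x => H.
have t20 : 0 < t ^+ 2 by rewrite exprn_gt0.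
rewrite -(ler_pM2l t20) -{1}(gtr0_norm t20) -normrM.
have -> : t ^+ 2 * (p - q) = (D - t ^+ 2 * q) - (D - t ^+ 2 * p) by ring.
apply: (le_trans (ler_normB _ _)); rewrite addrC.
by apply: (le_trans H); rewrite -mulrDl -splitr mulrC.
Qed.

End Schwarz.

Section RowSchwarz.
Variables (R : realType) (V : normedModType R).
Local Notation E := 'rV[R]_4.

Lemma derive_row_comm (f : V -> E) x v w :
  (\forall z \near x, differentiable f z) ->
  differentiable (fun z => 'D_v f z) x ->
  differentiable (fun z => 'D_w f z) x ->
  'D_w (fun z => 'D_v f z) x = 'D_v (fun z => 'D_w f z) x.
Proof.
move=> nf dv dw; apply/rowP => k.
have coord (u u' : V) : differentiable (fun z => 'D_u f z) x ->
  ('D_u' (fun z => 'D_u f z) x) ord0 k = 'D_u' (fun z => 'D_u (fun y => f y ord0 k : R) z) x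
  /\ differentiable (fun z => 'D_u (fun y => f y ord0 k : R) z) x.
  move=> du.
  have nE : \forall z \near x, ('D_u f z) ord0 k = 'D_u (fun y => f y ord0 k : R) z.
    apply: filterS nf => z df; rewrite derive_mx ?mxE//.
    exact: diff_derivable.
  split; last first.
    apply: near_eq_differentiable nE _.
    by move/differentiable_rV : du => /(_ k).
  rewrite derive_mx ?mxE; last exact: diff_derivable.
  exact: near_eq_derive.
have [E1 d1] := coord v w dv; have [E2 d2] := coord w v dw.
apply: (etrans E1); apply: (etrans _ (esym E2)).
apply: derive_comm => //; apply: filterS nf => z.
by move=> /differentiable_rV /(_ k).
Qed.

End RowSchwarz.

(** * Hopf fields are shear-free and geodesic *)

Section Fields.
Variable R : realType.
Local Notation E := 'rV[R]_4.
Implicit Types (X A B : E -> E) (x y v : E).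

Definition hext X : E -> E := X \o @radial_proj R.

Lemma hext_S3 X x : S3 x -> hext X x = X x.
Proof. by move=> xS; rewrite /hext/= radial_proj_id. Qed.

Lemma dS3_hextE X x v : smooth_on_S3 X -> x != 0 -> dS3 X x v = 'd (hext X) x v.
Proof.
by move=> sX x0; rewrite /dS3 deriveE//; exact: differentiable_homogeneous_ext.
Qed.

Lemma is_derive_hext X x v : smooth_on_S3 X -> S3 x ->
  is_derive x v (hext X) (dS3 X x v).
Proof.
move=> sX xS; apply: derivableP; apply: diff_derivable.
by apply: differentiable_homogeneous_ext => //; exact: S3_neq0.
Qed.

(** The derivatives of [A] and [B] along [X] cancel between the metric term and the brackets; what
    remains is the Killing operator, the symmetric part of the differential of [X]. *)
Lemma lie_metricE X A B x : smooth_on_S3 A -> smooth_on_S3 B -> S3 x ->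
  lie_metric X A B x = dot (dS3 X x (A x)) (B x) + dot (A x) (dS3 X x (B x)).
Proof.
move=> sA sB xS; rewrite /lie_metric /lie_bracket.
have H := is_derive_dot (is_derive_hext (X x) sA xS) (is_derive_hext (X x) sB xS).
have -> : dS3 (W := R^o) (fun y => dot (A y) (B y)) x (X x) =
  dot (dS3 A x (X x)) (B x) + dot (A x) (dS3 B x (X x)).
  by case: H => _; rewrite !hext_S3.
by rewrite dotBl dotBr; ring.
Qed.

Lemma inv_norm_S3 x : S3 x -> inv_norm x = 1.
Proof. by rewrite /S3/= /inv_norm => ->; rewrite sqrtr1 invr1. Qed.

Lemma dS3_linear_field X (M : 'M[R]_4) x v :
  (forall y, S3 y -> X y = y *m M) -> S3 x -> dot v x = 0 -> dS3 X x v = v *m M.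
Proof.
move=> XM xS vx; have x0 := S3_neq0 xS.
have := is_derive_mulmx M (is_derive_radial_proj v x0).
rewrite dotC vx inv_norm_S3// mulr0 oppr0 scale0r add0r scale1r => -[_ <-].
apply: near_eq_derive; near=> y; rewrite /= XM//; apply: radial_proj_S3.
by near: y; exact: near_neq0.
Unshelve. all: by end_near. Qed.

End Fields.

Section Hopf.
Variable R : realType.
Local Notation E := 'rV[R]_4.

Definition hopf_mx : 'M[R]_4 :=
  \matrix_(i, j) nth 0 (nth [::]
    [:: [:: 0; 1; 0; 0]; [:: -1; 0; 0; 0]; [:: 0; 0; 0; 1]; [:: 0; 0; -1; 0]] i) j.

Lemma sum4 (T : nmodType) (F : 'I_4 -> T) :
  \sum_i F i = F (inord 0) + F (inord 1) + F (inord 2) + F (inord 3).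
Proof.
rewrite !big_ord_recl big_ord0 addr0 !addrA.
by congr (F _ + F _ + F _ + F _); apply/val_inj; rewrite /= inordK.
Qed.

Lemma ord4P (P : 'I_4 -> Prop) :
  P (inord 0) -> P (inord 1) -> P (inord 2) -> P (inord 3) -> forall i, P i.
Proof.
move=> P0 P1 P2 P3 [[|[|[|[|i]]]] Hi] //.
- by rewrite (_ : Ordinal Hi = inord 0)//; apply/val_inj; rewrite /= inordK.
- by rewrite (_ : Ordinal Hi = inord 1)//; apply/val_inj; rewrite /= inordK.
- by rewrite (_ : Ordinal Hi = inord 2)//; apply/val_inj; rewrite /= inordK.
- by rewrite (_ : Ordinal Hi = inord 3)//; apply/val_inj; rewrite /= inordK.
Qed.

Lemma canonical_hopfE (x : E) : canonical_hopf x = x *m hopf_mx.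
Proof.
apply/rowP; apply: ord4P; rewrite !mxE sum4 !mxE !inordK//=; ring.
Qed.

Lemma hopf_mx_tr : hopf_mx^T = - hopf_mx.
Proof.
apply/matrixP; apply: ord4P; apply: ord4P; rewrite !mxE !inordK//=; ring.
Qed.

Lemma hopf_mx_sqr : hopf_mx *m hopf_mx = - 1%:M.
Proof.
by apply/matrixP; apply: ord4P; apply: ord4P;
  rewrite !mxE sum4 !mxE -val_eqE/= !inordK//=; ring.
Qed.

End Hopf.

Section LinearFlow.
Variable R : realType.
Local Notation E := 'rV[R]_4.

Lemma Ck_on_mulmx (V : normedModType R) k (U : set V) (f : V -> E) (L : 'M[R]_4) :
  open U -> Ck_on k U f -> Ck_on k U (fun x => f x *m L).
Proof.
move=> oU; elim: k f L => [|k IH] f L /=.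
  move=> cf x Ux.
  apply: (@continuous_comp _ _ _ f (fun u : E => u *m L)); first exact: cf.
  by apply: differentiable_continuous; apply: differentiable_mulmx.
move=> [df Cf]; split=> [x Ux|v].
  by apply: differentiable_mulmx; exact: df.
apply: (Ck_on_ext oU _ (IH _ L (Cf v))) => x Ux.
have := is_derive_mulmx L (derivableP (diff_derivable (v := v) (df x Ux))).
by case=> _ ->.
Qed.

Variables (M : 'M[R]_4) (I : set R) (c : R -> E).
Hypothesis oI : open I.
Hypothesis cM : forall t, I t -> is_derive (t : R^o) 1 c (c t *m M).

Lemma linear_flow_smooth : smooth_on (V := R^o) I c.
Proof.
elim=> [|k IH] /=.
  move=> t It; apply: differentiable_continuous.
  exact: is_derive_differentiable (cM It).
split=> [t It|v]; first exact: is_derive_differentiable (cM It).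
apply: (Ck_on_ext oI _ (Ck_on_mulmx (v *: M) oI IH)) => t It.
have dc := is_derive_differentiable (cM It).
have E1 : 'd c t (1 : R^o) = c t *m M.
  by rewrite -deriveE//; case: (cM It).
have -> : 'D_v c t = v *: 'd c t (1 : R^o).
  by rewrite deriveE// -linearZ; congr ('d c t _); rewrite -[RHS]/(v * 1) mulr1.
by rewrite E1 scalemxAr.
Qed.

Lemma linear_flow_derive2 t : I t -> derive1n 2 c t = c t *m M *m M.
Proof.
move=> It; rewrite /derive1n/= derive1E.
have [_ <-] := is_derive_mulmx M (cM It).
apply: near_eq_derive; apply: filterS (open_nbhs_nbhs (conj oI It)) => s Is.
by rewrite derive1E; case: (cM Is).
Qed.

End LinearFlow.

Section HopfIsShearFreeGeodesic.
Variable R : realType.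
Local Notation E := 'rV[R]_4.

(** The field is [x |-> x *m M] with [M] antisymmetric and [M ^ 2 = - 1]. Antisymmetry makes it a
    Killing field, so [lambda = 0]; the square gives [c'' = - c] along integral curves, which are
    geodesics with [phi = id]. *)
Lemma hopf_shear_free_geodesic (X : E -> E) :
  hopf_vector_field X -> shear_free_geodesic X.
Proof.
case=> -[[sX Xtan] X1] [Q [QQ XQ]].
have Qu : Q \in unitmx by case: (mulmx1_unit QQ).
have Qi : invmx Q = Q^T by rewrite -[RHS]mul1mx -(mulVmx Qu) -mulmxA QQ mulmx1.
pose M := Q^T *m hopf_mx R *m Q.
have XM y : S3 y -> X y = y *m M.
  by move=> yS; rewrite XQ// /Defs.pushforward canonical_hopfE Qi /M !mulmxA.
have MT : M^T = - M.
  by rewrite /M !trmx_mul trmxK hopf_mx_tr mulNmx mulmxN mulmxA.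
have MM : M *m M = - 1%:M.
  rewrite /M -!mulmxA (mulmxA Q) QQ mul1mx (mulmxA (hopf_mx R)) hopf_mx_sqr.
  by rewrite mulNmx mul1mx mulmxN -Qi mulVmx.
split.
  exists (fun=> 0); split.
    move=> x xS; exists setT, (fun=> 0); split=> //; first exact: openT.
    by move=> k; exact: Ck_on_cst.
  move=> A B [sA Atan] [sB Btan] XA XB x xS; rewrite mul0r lie_metricE//.
  rewrite !(dS3_linear_field XM)//; [|exact: Btan|exact: Atan].
  by rewrite dot_mulmx MT mulmxN dotNr addNr.
move=> I c oI ic; exists I, id.
have cM t : I t -> is_derive (t : R^o) 1 c (c t *m M).
  by move=> It; have [cS dc] := ic t It; rewrite -XM.
split=> //.
- by move=> k; exact: Ck_on_id.
- by move=> s _; rewrite derive1_id oner_neq0.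
- by rewrite image_id.
- split; first by apply: linear_flow_smooth cM; case: oI.
  move=> t It; have [cS _] := ic t It; split=> //.
  have [oI' _] := oI; have E2 := linear_flow_derive2 oI' cM It.
  change (tangent_proj (c t) (derive1n 2 c t) = 0).
  rewrite E2 -mulmxA MM mulmxN mulmx1 /tangent_proj dotNl cS scaleNr scale1r.
  by rewrite opprK addNr.
Qed.

End HopfIsShearFreeGeodesic.

(** * Existence of integral curves *)

Section PicardLindelof.
Variable R : realType.
Local Notation E := 'rV[R]_4.
Implicit Types (t e K : R).

Lemma row_norm_le (u : E) e : 0 <= e ->
  (forall k, `|u ord0 k| <= e) -> `|u| <= e.
Proof.
move=> e0 H; rewrite /Num.Def.normr/= mx_normrE; apply: bigmax_le => // -[i k] _.
by rewrite /= (ord1 i).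
Qed.

Lemma row_coord_le (u : E) k : `|u ord0 k| <= `|u|.
Proof. by rewrite [leRHS]/Num.Def.normr/= mx_normrE; exact: (le_bigmax _ _ (ord0, k)). Qed.

(** The nonexpansive retraction of the line onto [[a, b]]: it extends maps beyond an interval or a
    box while keeping continuity and Lipschitz constants. *)
Definition clamp (a b t : R) : R := Num.max a (Num.min t b).

Lemma clampP a b t : a <= b -> a <= clamp a b t <= b.
Proof.
by move=> ab; rewrite /clamp; apply/andP; split; rewrite ?le_max ?lexx// ge_max ab ge_min lexx orbT.
Qed.

Lemma clamp_id a b t : a <= t <= b -> clamp a b t = t.
Proof. by move=> /andP[at1 tb]; rewrite /clamp min_l// max_r. Qed.

Lemma clamp_lipschitz a b t t' : `|clamp a b t - clamp a b t'| <= `|t - t'|.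
Proof.
have maxL (x y : R) : `|Num.max a x - Num.max a y| <= `|x - y|.
  rewrite ler_norml.
  have := ler_norm (x - y); have := ler_norm (y - x); rewrite (distrC y).
  by case: (leP a x) => h1; case: (leP a y) => h2; lra.
have minL (x y : R) : `|Num.min x b - Num.min y b| <= `|x - y|.
  rewrite ler_norml.
  have := ler_norm (x - y); have := ler_norm (y - x); rewrite (distrC y).
  by case: (leP x b) => h1; case: (leP y b) => h2; lra.
exact: (le_trans (maxL _ _) (minL _ _)).
Qed.

Lemma lipschitz_continuous (V W : normedModType R) (f : V -> W) (L : R) :
  0 < L -> (forall x y, `|f x - f y| <= L * `|x - y|) -> continuous f.
Proof.
move=> L0 fL x; apply/cvgrPdist_le => /= e e0.
have eL : 0 < e / L by rewrite divr_gt0.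
have c : id @ x --> x by exact: cvg_id.
have /cvgrPdist_le/(_ _ eL) := c; apply: filterS => y.
by move=> h; apply: (le_trans (fL _ _)); rewrite mulrC -ler_pdivlMr.
Qed.

Lemma clamp_continuous a b : continuous (clamp a b : R -> R).
Proof.
apply: (@lipschitz_continuous R^o R^o _ 1) => // x y.
by rewrite mul1r; exact: clamp_lipschitz.
Qed.

Lemma real_antiderivative (g : R -> R) (d : R) : continuous g -> 0 < d ->
  exists A : R -> R, forall t, `|t| < d -> is_derive t 1 A (g t).
Proof.
move=> cg d0.
have gi : (@lebesgue_measure R).-integrable `[- d, d] (EFin \o g).
  apply: continuous_compact_integrable; first exact: segment_compact.
  exact: continuous_subspaceT.
exists (fun x => \int[lebesgue_measure]_(t in `[- d, x]) g t)%R => t.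
rewrite ltr_norml => /andP[dt td].
have [dA EA] := continuous_FTC1_closed td gi dt (cg t).
by split=> //; rewrite -derive1E.
Qed.

(** Freezing [A] outside [[- d, d]] keeps it continuous on the whole line, so that Picard iterates
    are continuous maps [R -> E] and bounds on [[- d, d]] hold everywhere. *)
Lemma antiderivative (G : R -> E) (d : R) (x0 : E) : continuous G -> 0 < d ->
  exists A : R -> E, [/\ continuous A, A 0 = x0,
    forall t, `|t| < d -> is_derive t 1 A (G t) &
    forall t, A t = A (clamp (- d) d t)].
Proof.
move=> cG d0.
(* The margin 1 makes the antiderivatives differentiable, hence continuous, at the endpoints [- d]
   and [d] too. *)
have d1 : 0 < d + 1 by rewrite ltr_wpDl// ltW.
have dd : - d <= d by rewrite ge0_cp// ltW.
have Ak k : exists A : R -> R, forall t, `|t| < d + 1 -> is_derive t 1 A (G t ord0 k).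
  apply: real_antiderivative => // t.
  by apply: (@continuous_comp _ _ _ G (fun u : E => u ord0 k)); [exact: cG | exact: coord_continuous].
have [A AP] := choice Ak.
pose c := clamp (- d) d.
have cd t : `|c t| < d + 1.
  by rewrite (@le_lt_trans _ _ d) ?ltrDl// ler_norml; exact: clampP.
have c_id t : `|t| <= d -> c t = t by rewrite ler_norml => /clamp_id.
have c0 : c 0 = 0 by rewrite c_id// normr0 ltW.
exists (fun t => \row_k (A k (c t) - A k 0 + x0 ord0 k)); split.
- have cA k : continuous (fun t => A k (c t) - A k 0 + x0 ord0 k : R).
    move=> t; apply: cvgD; last exact: cvg_cst.
    apply: cvgB; last exact: cvg_cst.
    apply: (@continuous_comp _ _ _ c (A k)); first exact: clamp_continuous.
    apply/differentiable_continuous/derivable1_diffP.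
    by case: (AP k _ (cd t)).
  move=> t; apply/cvgrPdist_le => /= e e0.
  have nk : \forall s \near t, forall k, `|(A k (c t) - A k 0 + x0 ord0 k) -
      (A k (c s) - A k 0 + x0 ord0 k)| <= e.
    have nk k : \forall s \near t, `|(A k (c t) - A k 0 + x0 ord0 k) -
      (A k (c s) - A k 0 + x0 ord0 k)| <= e.
      by have /cvgrPdist_le := cA k t; apply.
    exact: (@filter_forall _ _ _ (nbhs t) _ nk).
  apply: filterS nk => s sk; apply: row_norm_le; first exact: ltW.
  by move=> k; rewrite !mxE.
- by apply/rowP => k; rewrite mxE c0 subrr add0r.
- move=> t td; apply/is_derive_rV => k.
  have h : is_derive t 1 (fun s => A k s - A k 0 + x0 ord0 k) (G t ord0 k).
    have td1 : `|t| < d + 1 by rewrite (lt_trans td)// ltrDl.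
    have h := is_derive_add (is_derive_sub (AP k t td1) (is_derive_const (A k 0) t 1))
      (is_derive_const (x0 ord0 k) t 1).
    by apply: (is_derive_eq h); rewrite subr0 addr0.
  apply: near_eq_is_derive h.
  have nC : (fun z : R => `|z|) @ t --> `|t| by exact: norm_continuous.
  have H : \forall s \near t, `|s| < d by exact: (nC _ (lt_nbhsl td)).
  apply: filterS H => s sd.
  by rewrite mxE c_id// ltW.
- move=> t; apply/rowP => k; rewrite !mxE (c_id (clamp _ _ _))//.
  by rewrite ler_norml; exact: clampP.
Qed.

Lemma mean_value_bound (u du : R -> E) (d K : R) : 0 < d -> 0 <= K -> continuous u ->
  u 0 = 0 -> (forall t, `|t| < d -> is_derive t 1 u (du t)) ->
  (forall t, `|t| < d -> `|du t| <= K) ->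
  forall t, `|t| <= d -> `|u t| <= K * d.
Proof.
move=> d0 K0 cu u0 hu hK t td; apply: row_norm_le => [|k].
  by rewrite mulr_ge0// ltW.
pose v s : R := u s ord0 k; pose dv s : R := du s ord0 k.
have cv : continuous v.
  by move=> s; apply: (@continuous_comp _ _ _ u (fun w : E => w ord0 k)); [exact: cu | exact: coord_continuous].
have hv (s : R) : `|s| < d -> is_derive s 1 v (dv s).
  by move=> /hu /is_derive_rV /(_ k).
have bound (s r : R) : `|s| < d -> `|r| <= d -> `|dv s * r| <= K * d.
  move=> sd rd; rewrite normrM ler_pM//.
  by apply: (le_trans (row_coord_le _ _)); exact: hK.
have v0 : v 0 = 0 by rewrite /v u0 mxE.
rewrite -/(v t); have := td; rewrite ler_norml => /andP[dt td'].
have [t0|t0|<-] := ltgtP 0 t.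
- have [|s|s + E1] := @MVT R v dv 0 t t0.
  + move=> s; rewrite in_itv/= => /andP[s0 st]; apply: hv.
    by rewrite gtr0_norm// (lt_le_trans st).
  + exact: continuous_subspaceT.
  rewrite in_itv/= => /andP[s0 st].
  rewrite v0 !subr0 in E1; rewrite E1; apply: bound => //.
  by rewrite gtr0_norm// (lt_le_trans st).
- have [|s|s + E1] := @MVT R v dv t 0 t0.
  + move=> s; rewrite in_itv/= => /andP[ts s0]; apply: hv.
    by rewrite ltr0_norm// ltrNl (le_lt_trans dt).
  + exact: continuous_subspaceT.
  rewrite in_itv/= => /andP[ts s0].
  rewrite v0 !sub0r in E1; rewrite -normrN E1; apply: bound => //; last by rewrite normrN.
  by rewrite ltr0_norm// ltrNl (le_lt_trans dt).
- by rewrite v0 normr0 mulr_ge0// ltW.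
Qed.

Theorem picard_lindelof (f : E -> E) (L M : R) (x0 : E) : 0 < L -> 0 <= M ->
  (forall x y, `|f x - f y| <= L * `|x - y|) -> (forall x, `|f x| <= M) ->
  exists d : R, 0 < d /\ exists c : R -> E,
    c 0 = x0 /\ forall t, `|t| < d -> is_derive t 1 c (f (c t)).
Proof.
(* With this [d] the Picard operator halves uniform distances: [L * K * d = K / 2]. *)
move=> L0 M0 fL fM; pose d := (2 * L)^-1.
have d0 : 0 < d by rewrite invr_gt0 mulr_gt0.
have dd : - d <= d by rewrite ge0_cp// ltW.
have cf := lipschitz_continuous L0 fL.
(* Stated for every [c] so that [choice] yields a total operator [T]; discontinuous curves get a
   dummy value. *)
have step (c : R -> E) : exists A : R -> E, continuous c ->
    [/\ continuous A, A 0 = x0,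
      forall t, `|t| < d -> is_derive t 1 A (f (c t)) &
      forall t, A t = A (clamp (- d) d t)].
  have [cc|ncc] := pselect (continuous c); last by exists c.
  have [|A HA] := @antiderivative (f \o c) d x0 _ d0; last by exists A.
  by move=> t; apply: continuous_comp; [exact: cc | exact: cf].
have [T TP] := choice step.
have Tc c : continuous c -> continuous (T c) by move=> /TP[].
have contract c c' K : 0 <= K -> continuous c -> continuous c' ->
    (forall t, `|c t - c' t| <= K) -> forall t, `|T c t - T c' t| <= K / 2.
  move=> K0 cc cc' cK t.
  have [TA T0 TD Tcl] := TP c cc; have [TA' T0' TD' Tcl'] := TP c' cc'.
  have -> : K / 2 = L * K * d by rewrite /d; field; rewrite gt_eqF.
  rewrite Tcl Tcl'; apply: (@mean_value_bound (fun t => T c t - T c' t)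
    (fun t => f (c t) - f (c' t))) => //.
  - by rewrite mulr_ge0// ltW.
  - by move=> s; apply: cvgB; [exact: TA | exact: TA'].
  - by rewrite T0 T0' subrr.
  - by move=> s sd; apply: is_derive_sub; [exact: TD | exact: TD'].
  - by move=> s sd; apply: (le_trans (fL _ _)); rewrite ler_pM2l.
  - by rewrite ler_norml; exact: clampP.
pose y n := iter n T (fun=> x0).
have cy n : continuous (y n).
  by elim: n => [|n IH]; [move=> t; exact: cvg_cst | exact: Tc].
have yS n : y n.+1 = T (y n) by [].
pose C := M * d.
have C0 : 0 <= C by rewrite mulr_ge0// ltW.
have y01 t : `|y 1%N t - y 0%N t| <= C.
  have [TA T0 TD Tcl] := TP (y 0%N) (cy 0%N).
  rewrite yS Tcl; apply: (@mean_value_bound (fun t => T (y 0%N) t - x0)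
    (fun t => f (y 0%N t))) => //.
  - by move=> s; apply: cvgB; [exact: TA | exact: cvg_cst].
  - by rewrite T0 subrr.
  - move=> s sd; apply: (is_derive_eq (is_derive_sub (TD s sd) (is_derive_const x0 s 1))).
    by rewrite subr0.
  - by rewrite ler_norml; exact: clampP.
have p2 n : 0 < (2 ^+ n : R) by rewrite exprn_gt0.
have yn n t : `|y n.+1 t - y n t| <= C / 2 ^+ n.
  elim: n t => [|n IH] t; first by rewrite expr0 divr1; exact: y01.
  rewrite (yS n.+1) {2}(yS n) exprSr invfM mulrA; apply: contract => //.
  by rewrite divr_ge0// ltW.
(* The bound is the exact telescoped geometric sum, so the induction step closes with an
   equality. *)
have ymn n m t : `|y (n + m)%N t - y n t| <= 2 * C / 2 ^+ n - 2 * C / 2 ^+ (n + m).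
  elim: m => [|m IH]; first by rewrite addn0 !subrr normr0.
  have -> : y (n + m.+1)%N t - y n t =
    (y (n + m).+1 t - y (n + m)%N t) + (y (n + m)%N t - y n t).
    by rewrite addnS addrA subrK.
  apply: (le_trans (ler_normD _ _)); apply: (le_trans (lerD (yn _ _) IH)).
  rewrite addnS exprSr le_eqVlt; apply/orP; left; apply/eqP.
  by field; rewrite !gt_eqF.
have ymn' n m t : (n <= m)%N -> `|y m t - y n t| <= 2 * C / 2 ^+ n.
  move=> nm; rewrite -(subnKC nm); apply: (le_trans (ymn _ _ _)).
  by rewrite gerBl divr_ge0// ?mulr_ge0// ltW.
have eps e : 0 < e -> exists n, 2 * C / 2 ^+ n <= e.
  move=> e0; pose e' := e / (2 * C + 1).
  have C1 : 0 < 2 * C + 1 by rewrite ltr_wpDl// mulr_ge0.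
  have e'0 : 0 < e' by rewrite divr_gt0.
  have [n _ Hn] := near_infty_natSinv_expn_lt (PosNum e'0).
  exists n; have /ltW := Hn n (leqnn n); rewrite /= div1r ler_pdivlMr// => Hn'.
  apply: le_trans Hn'; rewrite mulrC ler_pM2l ?invr_gt0// lerDl//.
have limy (t : R) : exists z : E, y n t @[n --> \oo] --> z.
  suff cyt : cvg ((fun n => y n t) @ \oo) by exists (lim ((fun n => y n t) @ \oo)).
  apply: cauchy_cvg; apply: cauchy_exP => e e0.
  have [n Hn] := eps (e / 2) (divr_gt0 e0 (ltr0n _ 2)).
  exists (y n t); exists n => // m /= nm; rewrite -ball_normE/= distrC.
  apply: (le_lt_trans (ymn' n m t nm)); apply: (le_lt_trans Hn).
  by rewrite ltr_pdivrMr// mulr_natr mulr2n ltrDl.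
have [z zP] := choice limy.
have zy n t : `|z t - y n t| <= 2 * C / 2 ^+ n.
  apply/ler_addgt0Pl => e e0.
  have /cvgrPdist_le/(_ e e0)[N _ HN] := zP t.
  have h1 := HN (maxn N n) (leq_maxl _ _).
  have h2 := ymn' n (maxn N n) t (leq_maxr _ _).
  rewrite -(subrKA (y (maxn N n) t)).
  by apply: (le_trans (ler_normD _ _)); exact: lerD.
have cz : continuous z.
  move=> t; apply/cvgrPdist_le => /= e e0.
  have e30 : 0 < e / 3 by rewrite divr_gt0.
  have [n Hn] := eps _ e30.
  near=> s.
  have -> : z t - z s = (z t - y n t) + (y n t - y n s) - (z s - y n s).
    by rewrite subrKA opprB addrA subrK.
  have h1 := le_trans (zy n t) Hn; have h2 := le_trans (zy n s) Hn.
  have h3 : `|y n t - y n s| <= e / 3.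
    by near: s; have /cvgrPdist_le := cy n t; apply.
  apply: (le_trans (ler_normB _ _)).
  apply: (le_trans (lerD (ler_normD _ _) (lexx _))).
  apply: (le_trans (lerD (lerD h1 h3) h2)).
  by rewrite le_eqVlt; apply/orP; left; apply/eqP; field.
have Tz t : T z t = z t.
  apply/eqP; rewrite -subr_eq0 -normr_le0; apply/ler_addgt0Pl => e e0; rewrite addr0.
  have [n Hn] := eps e e0.
  have h1 := contract z (y n) _ (divr_ge0 (mulr_ge0 (ler0n _ 2) C0) (ltW (p2 n))) cz (cy n) (zy n) t.
  have h2 := zy n.+1 t; rewrite -(subrKA (y n.+1 t)).
  apply: (le_trans (ler_normD _ _)); rewrite (distrC (y n.+1 t)).
  apply: (le_trans (lerD h1 h2)); apply: le_trans Hn.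
  rewrite exprSr le_eqVlt; apply/orP; left; apply/eqP.
  by field; rewrite gt_eqF.
have Tzz : T z = z by rewrite funeqE.
have [_ T0 TD _] := TP z cz.
by exists d; split=> //; exists z; split; [rewrite -Tzz | move=> t td; rewrite -{1}Tzz; exact: TD].
Unshelve. all: by end_near. Qed.

End PicardLindelof.

(** * Local flows of C^1 maps *)

Section LocalLipschitz.
Variable R : realType.
Local Notation E := 'rV[R]_4.

(** Continuous partial derivatives are bounded near [x]; the mean value theorem along the segment
    from [z] to [y], coordinate by coordinate, turns the bound into a Lipschitz constant. *)
Lemma C1_local_lipschitz (s : E -> E) (x : E) :
  (\forall y \near x, differentiable s y) ->
  (forall k, {for x, continuous (fun y => 'D_(delta_mx ord0 k) s y)}) ->
  exists r L : R, [/\ 0 < r, 0 < L & forall y z, `|y - x| <= r -> `|z - x| <= r ->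
    `|s y - s z| <= L * `|y - z|].
Proof.
move=> nds cds; pose D k y : E := 'D_(delta_mx ord0 k) s y.
pose B k := `|D k x| + 1.
have nB : \forall y \near x, forall k, `|D k y| <= B k.
  have nB k : \forall y \near x, `|D k y| <= B k.
    have /cvgrPdist_le/(_ 1 ltr01) := cds k; apply: filterS => y yx.
    rewrite /B; have := ler_normB (D k x) (D k x - D k y).
    rewrite opprB addrCA subrr addr0 => h; apply: (le_trans h).
    by rewrite lerD2l.
  exact: (@filter_forall _ _ _ (nbhs x) _ nB).
have [d d0 dP] := near_radius (filterI nds nB).
have B0 k : 0 <= B k by rewrite /B addr_ge0.
pose L := 1 + \sum_k B k.
have L0 : 0 < L by rewrite /L ltr_pwDl// sumr_ge0.
have d20 : 0 < d / 2 by rewrite divr_gt0.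
exists (d / 2), L; split=> // y z yx zx.
apply: row_norm_le => [|j]; first by rewrite mulr_ge0// ltW.
pose c (t : R) : E := t *: (y - z) + z.
have cx t : 0 <= t <= 1 -> `|c t - x| < d.
  move=> /andP[t0 t1].
  have -> : c t - x = t *: (y - x) + (1 - t) *: (z - x).
    rewrite /c !scalerBr !scalerBl !scale1r.
    by apply/rowP => k; rewrite !mxE; ring.
  apply: (@le_lt_trans _ _ (d / 2)); last by rewrite ltr_pdivrMr// mulr_natr mulr2n ltrDl.
  apply: (le_trans (ler_normD _ _)); rewrite !normrZ !ger0_norm ?subr_ge0//.
  have t1' : 0 <= 1 - t by rewrite subr_ge0.
  have h1 := ler_wpM2l t0 yx; have h2 := ler_wpM2l t1' zx.
  by apply: (le_trans (lerD h1 h2)); rewrite -mulrDl addrC subrK mul1r.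
have hc (t : R) : is_derive t 1 c (y - z).
  have dl : differentiable ( *:%R^~ (y - z) : R -> E) t by [].
  have h : is_derive t 1 (fun t : R => t *: (y - z)) (y - z).
    by split; [exact/derivable1_diffP | rewrite deriveE// diff_val scale1r].
  by apply: (is_derive_eq (is_derive_add h (is_derive_const z t 1))); rewrite addr0.
pose g t : R := s (c t) ord0 j.
pose dg t : R := ('d s (c t) (y - z)) ord0 j.
have hg (t : R) : 0 <= t <= 1 -> is_derive t 1 g (dg t).
  move=> /cx /dP[ds _].
  by have /is_derive_rV/(_ j) := is_derive_chain ds (hc t).
have in01 (t : R) : t \in `]0, 1[%R -> 0 <= t <= 1.
  by rewrite in_itv/= => /andP[/ltW -> /ltW ->].
have [|t t01 Et] := MVT (@ltr01 R) (fun t ht => hg t (in01 t ht)).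
  by apply: derivable_within_continuous => t; rewrite in_itv/= => /hg[].
have -> : (s y - s z) ord0 j = dg t.
  rewrite subr0 mulr1 in Et; rewrite -Et /g /c scale1r scale0r add0r subrK.
  by rewrite !mxE.
have [ds DB] := dP _ (cx t (in01 t t01)).
rewrite /dg; set u := y - z.
apply: (le_trans (row_coord_le _ _)).
rewrite [X in 'd s _ X]row_sum linear_sum.
apply: (le_trans (ler_norm_sum _ _ _)).
rewrite /L mulrDl mul1r mulr_suml ler_wpDl// ler_sum// => k _.
rewrite linearZ/= normrZ -deriveE// mulrC ler_pM//; first exact: DB.
exact: row_coord_le.
Qed.

(** Retraction onto the closed sup-norm ball of radius [r] at [x], nonexpansive because it acts on
    coordinates. Composing with it makes a locally Lipschitz map globally Lipschitz and bounded. *)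
Definition box_clamp (x : E) (r : R) (y : E) : E :=
  \row_k clamp (x ord0 k - r) (x ord0 k + r) (y ord0 k).

Lemma box_clamp_lipschitz x r y z : `|box_clamp x r y - box_clamp x r z| <= `|y - z|.
Proof.
apply: row_norm_le => // k; rewrite !mxE.
apply: (le_trans (clamp_lipschitz _ _ _ _)).
by apply: le_trans (row_coord_le (y - z) k); rewrite !mxE.
Qed.

Lemma box_clamp_near x r y : 0 <= r -> `|box_clamp x r y - x| <= r.
Proof.
move=> r0; apply: row_norm_le => // k; rewrite !mxE ler_norml.
have : x ord0 k - r <= x ord0 k + r by lra.
by move=> /(clampP (y ord0 k)) /andP[h1 h2]; apply/andP; split; lra.
Qed.

Lemma box_clamp_id x r y : `|y - x| <= r -> box_clamp x r y = y.
Proof.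
move=> yx; apply/rowP => k; rewrite mxE clamp_id//.
have := le_trans (row_coord_le (y - x) k) yx; rewrite !mxE ler_norml => /andP[h1 h2].
by apply/andP; split; lra.
Qed.

(** [picard_lindelof] applies to the clamped map; by continuity its solution stays for a short time
    in the box, where the clamp is the identity. *)
Lemma local_flow (s : E -> E) (x : E) :
  (\forall y \near x, differentiable s y) ->
  (forall k, {for x, continuous (fun y => 'D_(delta_mx ord0 k) s y)}) ->
  exists d : R, 0 < d /\ exists c : R -> E,
    c 0 = x /\ forall t : R, `|t| < d -> is_derive t 1 c (s (c t)).
Proof.
move=> nds cds; have [r [L [r0 L0 sL]]] := C1_local_lipschitz nds cds.
have bc y := box_clamp_near x y (ltW r0).
have [|y z|y|d1 [d10 [c [c0 cP]]]] :=
  @picard_lindelof R (s \o box_clamp x r) L (`|s x| + L * r) x L0.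
- by rewrite addr_ge0// mulr_ge0// ltW.
- apply: (le_trans (sL _ _ (bc _) (bc _))).
  by rewrite ler_pM2l// box_clamp_lipschitz.
- have -> : (s \o box_clamp x r) y = s x + (s (box_clamp x r y) - s x).
    by rewrite addrC subrK.
  apply: (le_trans (ler_normD _ _)); rewrite lerD2l.
  apply: (le_trans (sL _ _ (bc _) _)); first by rewrite subrr normr0 ltW.
  by rewrite ler_pM2l.
have cc : c @ (0 : R) --> x.
  have /differentiable_continuous : differentiable c (0 : R).
    by apply: is_derive_differentiable (cP 0 _); rewrite normr0.
  by rewrite /prop_for /continuous_at c0.
have ncx : \forall t \near (0 : R), `|x - c t| <= r by move/cvgrPdist_le : cc; apply.
have [d2 d20 d2P] := near0_radius ncx.
exists (Num.min d1 d2); rewrite lt_min d10 d20; split=> //; exists c; split=> // t.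
rewrite lt_min => /andP[td1 td2]; have := cP t td1.
by rewrite /= box_clamp_id// distrC; exact: d2P.
Qed.

Lemma derive0_constant (g : R -> R) (d : R) :
  (forall t : R, `|t| < d -> is_derive t 1 g 0) -> forall t, `|t| < d -> g t = g 0.
Proof.
move=> hg t td.
have dd (s : R) : `|s| <= `|t| -> `|s| < d by move=> /le_lt_trans; apply.
have [t0|t0|<-//] := ltgtP 0 t.
- have hs (s : R) : 0 <= s <= t -> is_derive s 1 g 0.
    by move=> /andP[s0 st]; apply/hg/dd; rewrite !ger0_norm// ltW.
  have hs' (s : R) : s \in `]0, t[%R -> is_derive s 1 g 0.
    by rewrite in_itv/= => /andP[s0 st]; apply: hs; rewrite !ltW.
  have [|s _] := MVT t0 hs'; last by rewrite mul0r => /eqP; rewrite subr_eq0 => /eqP.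
  by apply: derivable_within_continuous => s; rewrite in_itv/= => /hs[].
- have hs (s : R) : t <= s <= 0 -> is_derive s 1 g 0.
    by move=> /andP[ts s0]; apply/hg/dd; rewrite !ler0_norm ?lerN2// ltW.
  have hs' (s : R) : s \in `]t, 0[%R -> is_derive s 1 g 0.
    by rewrite in_itv/= => /andP[s0 st]; apply: hs; rewrite !ltW.
  have [|s _] := MVT t0 hs'.
    by apply: derivable_within_continuous => s; rewrite in_itv/= => /hs[].
  by rewrite mul0r => /eqP; rewrite subr_eq0 => /eqP.
Qed.

End LocalLipschitz.

(** * Unit vector fields and the geodesic condition *)

Section UnitField.
Variable R : realType.
Local Notation E := 'rV[R]_4.
Variable X : E -> E.
Hypothesis XU : unit_vector_field X.
Local Notation s := (hext X).
Implicit Types (x y v w : E) (t : R).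

Lemma unit_field_smooth : smooth_on_S3 X. Proof. by case: XU => -[]. Qed.

Lemma differentiable_hext y : y != 0 -> differentiable s y.
Proof. exact/differentiable_homogeneous_ext/unit_field_smooth. Qed.

Lemma dot_hext y : y != 0 -> dot (s y) y = 0.
Proof.
move=> y0; have [[_ tX] _] := XU; have pS := radial_proj_S3 y0.
have n0 := inv_norm_gt0 y0.
apply: (mulfI (lt0r_neq0 n0)); rewrite mulr0 -dotZr; exact: tX.
Qed.

Lemma dot_hext_hext y : y != 0 -> dot (s y) (s y) = 1.
Proof. by move=> y0; have [_ X1] := XU; apply: X1; exact: radial_proj_S3. Qed.

Lemma is_derive_hext_at y v : y != 0 -> is_derive y v s ('d s y v).
Proof.
move=> y0; have ds := differentiable_hext y0; rewrite -deriveE//.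
by apply: derivableP; exact: diff_derivable.
Qed.

Lemma is_derive_hext_curve (c : R -> E) t v : c t != 0 -> is_derive t 1 c v ->
  is_derive t 1 (fun r => s (c r)) ('d s (c t) v).
Proof. by move=> c0; apply: is_derive_chain; exact: differentiable_hext. Qed.

Lemma near_constant_derive (f : E -> R) y v (a d : R) :
  (forall z, z != 0 -> f z = a) -> y != 0 -> is_derive y v f d -> d = 0.
Proof.
move=> fa y0 [_ <-]; rewrite -(@derive_cst _ _ _ (a : R^o) y v).
by apply: near_eq_derive; near=> z; rewrite fa//; near: z; exact: near_neq0.
Unshelve. all: by end_near. Qed.

Lemma dot_dhext y v : y != 0 -> dot ('d s y v) y = - dot (s y) v.
Proof.
move=> y0; have h := is_derive_dot (is_derive_hext_at v y0) (is_derive_id y v).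
by apply/eqP; rewrite -addr_eq0; apply/eqP; exact: near_constant_derive dot_hext y0 h.
Qed.

Lemma dot_dhext_hext y v : y != 0 -> dot ('d s y v) (s y) = 0.
Proof.
move=> y0; have h0 := is_derive_hext_at v y0.
have /= := near_constant_derive dot_hext_hext y0 (is_derive_dot h0 h0).
by rewrite (dotC (s y)); lra.
Qed.

Lemma dhext_radial y : y != 0 -> 'd s y y = 0.
Proof.
move=> y0.
have hl : is_derive (1 : R) 1 (fun r : R => r *: y) y.
  have dl : differentiable ( *:%R^~ y : R -> E) (1 : R) by [].
  by split; [exact/derivable1_diffP | rewrite deriveE// diff_val scale1r].
have ly : 1 *: y != 0 by rewrite scale1r.
have := is_derive_hext_curve ly hl; rewrite scale1r => -[_ <-].
rewrite -(@derive_cst _ _ _ (s y) (1 : R) 1).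
apply: near_eq_derive; near=> r; rewrite /= /hext/= radial_projZ//.
by near: r; exact: lt_nbhsr.
Unshelve. all: by end_near. Qed.

(** The ambient flow of [s] preserves [dot c c] because [s] is orthogonal to the position, so a
    solution that starts on the sphere remains there. *)
Lemma integral_curve_exists x : S3 x -> exists d : R, 0 < d /\ exists c : R -> E,
  c 0 = x /\ integral_curve X `](- d), d[ c.
Proof.
move=> xS; have x0 := S3_neq0 xS.
have nds : \forall y \near x, differentiable s y.
  by apply: filterS (near_neq0 x0) => y; exact: differentiable_hext.
have cds k : {for x, continuous (fun y => 'D_(delta_mx ord0 k) s y)}.
  apply: differentiable_continuous; apply: differentiable_derive_homogeneous_ext => //.
  exact: unit_field_smooth.
have [d1 [d10 [c [c0 cP]]]] := local_flow nds cds.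
have cc : c @ (0 : R) --> x.
  have /differentiable_continuous : differentiable c (0 : R).
    by apply: is_derive_differentiable (cP 0 _); rewrite normr0.
  by rewrite /prop_for /continuous_at c0.
have ncx : \forall t \near (0 : R), c t != 0 by exact: (cvgr_neq0 _ cc x0).
have [d2 d20 d2P] := near0_radius ncx.
pose d := Num.min d1 d2.
have d0 : 0 < d by rewrite lt_min d10 d20.
have cS t : `|t| < d -> S3 (c t).
  move=> td; rewrite /S3/= -xS -c0.
  apply: (@derive0_constant _ (fun r => dot (c r) (c r)) d) => // r.
  rewrite lt_min => /andP[rd1 rd2].
  apply: (is_derive_eq (is_derive_dot (cP r rd1) (cP r rd1))).
  by rewrite (dotC (c r)) dot_hext ?addr0//; exact: d2P.
exists d; split=> //; exists c; split=> // t /=.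
rewrite in_itv/= -ltr_norml => td; split; first exact: cS.
rewrite -hext_S3; last exact: cS.
by apply: cP; move: td; rewrite lt_min => /andP[].
Qed.

Hypothesis Xgeo : forall (I : set R) (c : R -> E), open_interval I ->
  integral_curve X I c -> reparametrized_geodesic I c.

(** The hypothesis speaks only of integral curves, so one is first produced through [x]. If [a] and
    [b] are the first and second derivatives of [phi], the second derivative of [c \o phi] is
    [b s + a ^ 2 ds (s)]. Its tangential part vanishes; pairing with [s], to which [ds (s)] is
    orthogonal, forces [b = 0], and dividing by [a ^ 2] gives the claim. *)
Lemma geodesic_field x : S3 x -> 'd s x (s x) = - x.
Proof.
move=> xS; have x0 := S3_neq0 xS; have [d [d0 [c [c0 cI]]]] := integral_curve_exists xS.
have oI : open_interval `](- d), d[ by split; [exact: interval_open | exact: interval_is_interval].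
have [J [phi [[oJ _] sphi phi0 Jphi [sg geo]]]] := Xgeo oI cI.
have I0 : `](- d), d[%classic 0 by rewrite /= in_itv/= oppr_lt0 d0.
have : (phi @` J) 0 by rewrite Jphi.
move=> [r0 Jr0 phir0].
have [dphi Cphi] := sphi 1%N; have [dphi1 _] := sphi 2%N.
pose dp r : R := derive1 phi r.
have hphi r : J r -> is_derive r 1 phi (dp r).
  move=> Jr; rewrite /dp derive1E; apply: derivableP; apply: diff_derivable.
  exact: (dphi r Jr).
have hdp : is_derive r0 1 dp (derive1 dp r0).
  rewrite derive1E; apply: derivableP; apply: diff_derivable.
  have [_ /(_ (1 : R^o)) [H _]] := sphi 2%N.
  have -> : dp = (fun r => 'D_(1 : R^o) phi r) by rewrite funeqE => r; rewrite /dp derive1E.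
  exact: H.
have Iphi r : J r -> `](- d), d[%classic (phi r) by move=> Jr; rewrite -Jphi; exists r.
have hg r : J r -> is_derive r 1 (c \o phi) (dp r *: s (c (phi r))).
  move=> Jr; have [cS hc] := cI _ (Iphi r Jr).
  have dc := is_derive_differentiable hc.
  apply: (is_derive_eq (is_derive_chain dc (hphi r Jr))).
  rewrite -[X in 'd c _ X]mulr1 -[dp r * 1]/(dp r *: (1 : R^o)) linearZ/= hext_S3//.
  by congr (_ *: _); rewrite -deriveE//; case: hc.
have cr0 : c (phi r0) = x by rewrite phir0.
have hg2 : is_derive r0 1 (fun r => dp r *: s (c (phi r)))
    (derive1 dp r0 *: s x + dp r0 *: 'd s x (dp r0 *: s x)).
  have n0 : (c \o phi) r0 != 0 by rewrite /= cr0.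
  have h := is_derive_scale hdp (is_derive_hext_curve n0 (hg r0 Jr0)).
  by apply: (is_derive_eq h); rewrite /= cr0.
have E2 : derive1n 2 (c \o phi) r0 =
    derive1 dp r0 *: s x + dp r0 *: 'd s x (dp r0 *: s x).
  rewrite /derive1n/= derive1E; have [_ <-] := hg2.
  apply: near_eq_derive; apply: filterS (open_nbhs_nbhs (conj oJ Jr0)) => r Jr.
  by rewrite derive1E; case: (hg r Jr).
have [_] := geo r0 Jr0; rewrite E2 /= cr0 /tangent_proj linearZ/= scalerA.
set k := 'd s x (s x); set b := derive1 dp r0; set a := dp r0 => Ek.
have a0 : a != 0 := phi0 r0 Jr0.
have kx : dot k x = -1 by rewrite dot_dhext// dot_hext_hext.
have ks : dot k (s x) = 0 by rewrite dot_dhext_hext.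
have xs : dot x (s x) = 0 by rewrite dotC dot_hext.
have ss : dot (s x) (s x) = 1 by rewrite dot_hext_hext.
have sx : dot (s x) x = 0 by rewrite dotC.
have Ek' : b *: s x + (a * a) *: k = - (a * a) *: x.
  move/eqP : Ek; rewrite subr_eq0 => /eqP ->; congr (_ *: _).
  by rewrite dotDl !dotZl sx kx; ring.
have b0 : b = 0.
  have := congr1 (fun u => dot u (s x)) Ek'.
  by rewrite dotDl !dotZl ss ks xs; lra.
move: Ek'; rewrite b0 scale0r add0r scaleNr -scalerN => /(scalerI _); apply.
by rewrite mulf_neq0.
Qed.

End UnitField.

(** * Leaves are great circles; the shear-free identity *)

Section GreatCircles.
Variable R : realType.
Local Notation E := 'rV[R]_4.
Implicit Types (x y w : E) (t : R).

Definition great_circle x w t : E := cos t *: x + sin t *: w.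

Lemma great_circle0 x w : great_circle x w 0 = x.
Proof. by rewrite /great_circle cos0 sin0 scale1r scale0r addr0. Qed.

Lemma is_derive_great_circle x w t :
  is_derive t 1 (great_circle x w) (great_circle w (- x) t).
Proof.
have h := is_derive_add
  (is_derive_scale (is_derive_cos t) (is_derive_const x t 1))
  (is_derive_scale (is_derive_sin t) (is_derive_const w t 1)).
apply: (is_derive_eq h).
by rewrite !scaler0 !addr0 /great_circle scaleNr scalerN addrC.
Qed.

Lemma great_circle_S3 x w t : S3 x -> S3 w -> dot x w = 0 -> S3 (great_circle x w t).
Proof.
rewrite /S3/= /great_circle => xx ww xw.
rewrite !dotDl !dotDr !dotZl !dotZr xx ww (dotC w) xw.
by have := cos2Dsin2 t; lra.
Qed.

(** The product [N t * exp (- C t)] is nonincreasing and starts at 0. *)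
Lemma gronwall0 (N dN : R -> R) (C T : R) : 0 < T -> N 0 = 0 -> 0 <= N T ->
  (forall t, 0 <= t <= T -> is_derive t 1 N (dN t)) ->
  (forall t, 0 <= t <= T -> dN t <= C * N t) -> N T = 0.
Proof.
move=> T0 N0 NT hN hC.
pose e t : R := expR (- C * t).
have he (t : R) : is_derive t 1 e (- C * e t).
  have hl : is_derive t 1 (fun r : R => - C * r) (- C).
    have h := is_derive_mul (is_derive_const (- C : R) t 1) (is_derive_id t (1 : R)).
    by apply: (is_derive_eq h); rewrite mul0r add0r mulr1.
  have de := is_derive_differentiable (is_derive_expR (- C * t)).
  apply: (is_derive_eq (is_derive_chain de hl)).
  rewrite -[X in 'd _ _ X]mulr1 -[- C * 1]/(- C *: (1 : R^o)) linearZ/=.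
  congr (_ * _); rewrite -deriveE//; exact: derive_val.
pose g t := N t * e t.
have hg t : 0 <= t <= T -> is_derive t 1 g ((dN t - C * N t) * e t).
  move=> ht; apply: (is_derive_eq (is_derive_mul (hN t ht) (he t))); ring.
have in0T t : t \in `]0, T[%R -> 0 <= t <= T.
  by rewrite in_itv/= => /andP[/ltW -> /ltW ->].
have [|t t0T] := MVT T0 (fun t ht => hg t (in0T t ht)).
  by apply: derivable_within_continuous => t; rewrite in_itv/= => /hg[].
rewrite {2}/g N0 mul0r !subr0 => gT.
have : g T <= 0.
  rewrite gT pmulr_lle0// pmulr_lle0 ?expR_gt0// subr_le0.
  exact/hC/in0T.
rewrite /g pmulr_lle0 ?expR_gt0// => NT0.
by apply/eqP; rewrite eq_le NT0 NT.
Qed.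

Lemma coord_sqr_le_dot (e : E) : `|e| ^+ 2 <= dot e e.
Proof.
have dk k : `|e ord0 k| ^+ 2 <= dot e e.
  rewrite real_normK ?num_real// /dot (bigD1 k)//= -expr2 lerDl.
  by apply: sumr_ge0 => i _; rewrite -expr2 sqr_ge0.
have h : `|e| <= Num.sqrt (dot e e).
  apply: row_norm_le; first exact: sqrtr_ge0.
  by move=> k; rewrite -(ler_pXn2r (ltn0Sn 1)) ?nnegrE ?sqrtr_ge0// sqr_sqrtr ?dot_ge0.
have := h; rewrite -(ler_pXn2r (ltn0Sn 1)) ?nnegrE ?sqrtr_ge0//.
by rewrite sqr_sqrtr ?dot_ge0.
Qed.

Lemma dot_le_norm (u e : E) : dot u e <= 4 * `|u| * `|e|.
Proof.
rewrite -mulrA mulr_natl -[X in _ *+ X](card_ord 4) -sumr_const.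
apply: ler_sum => k _; apply: (le_trans (ler_norm _)).
by rewrite normrM ler_pM// row_coord_le.
Qed.

End GreatCircles.

Section GeodesicUnitField.
Variable R : realType.
Local Notation E := 'rV[R]_4.
Variable X : E -> E.
Hypothesis XU : unit_vector_field X.
Local Notation s := (hext X).
Local Notation ds := (fun y => 'd s y).
Implicit Types (x y v w a b : E) (t : R).

Hypothesis Xg : forall x, S3 x -> 'd s x (s x) = - x.

Lemma hext_unit x : S3 x -> S3 (s x).
Proof. by move=> /S3_neq0 x0; exact: dot_hext_hext. Qed.

Lemma dot_x_hext x : S3 x -> dot x (s x) = 0.
Proof. by move=> /S3_neq0 x0; rewrite dotC; exact: dot_hext. Qed.

Lemma dhext_sum y v : y != 0 ->
  'd s y v = \sum_k v ord0 k *: 'D_(delta_mx ord0 k) s y.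
Proof.
move=> y0; rewrite [X in 'd s _ X]row_sum linear_sum; apply: eq_bigr => k _.
by rewrite linearZ/= -deriveE//; exact: (differentiable_hext XU).
Qed.

(* Uniqueness of integral curves: [e := s (c t) - c' t] satisfies the linear
   equation [e' = - ds e]. *)
Lemma hext_great_circle_ge0 x t : S3 x -> 0 < t ->
  s (great_circle x (s x) t) = great_circle (s x) (- x) t.
Proof.
move=> xS T0; set c := great_circle x (s x); set c' := great_circle (s x) (- x).
have cS r : S3 (c r).
  by apply: great_circle_S3 => //; [exact: hext_unit | exact: dot_x_hext].
have c0 r : c r != 0 by exact: S3_neq0.
pose e r := s (c r) - c' r.
(* Since [c' = s (c) - e], linearity and [Xg] give [ds (c') = - c - ds (e)], while [c'' = - c]. *)
have he (r : R) : is_derive r 1 e (- 'd s (c r) (e r)).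
  have h1 := is_derive_hext_curve XU (c0 r) (is_derive_great_circle x (s x) r).
  have h2 := is_derive_great_circle (s x) (- x) r.
  apply: (is_derive_eq (is_derive_sub h1 h2)).
  rewrite /e linearB/= Xg// -/c'.
  have -> : great_circle (- x) (- s x) r = - c r.
    by rewrite /great_circle /c /great_circle !scalerN opprD.
  by rewrite !opprB opprK addrC.
pose K r := \sum_k `|'D_(delta_mx ord0 k) s (c r)|.
have cK : continuous K.
  have cn k : continuous (fun r => `|'D_(delta_mx ord0 k) s (c r)| : R).
    move=> z; apply: (@continuous_comp _ _ _ (fun r => 'D_(delta_mx ord0 k) s (c r))
      (fun u : E => `|u|)); last exact: norm_continuous.
    apply: (@continuous_comp _ _ _ c (fun y => 'D_(delta_mx ord0 k) s y)).
      apply: differentiable_continuous.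
      exact: is_derive_differentiable (is_derive_great_circle x (s x) z).
    apply: differentiable_continuous.
    by apply: differentiable_derive_homogeneous_ext => //; exact: unit_field_smooth.
  rewrite /K; under eq_fun do rewrite sum4.
  by move=> r; apply: cvgD; [apply: cvgD; [apply: cvgD|]|]; exact: cn.
have [m _ mP] := EVT_max (ltW T0) (continuous_subspaceT cK).
pose N r := dot (e r) (e r).
suff : N t = 0 by move=> /eqP; rewrite dot_eq0 subr_eq0 => /eqP.
(* In the constant, 4 comes from comparing [dot] with the sup norm, another 2 from the product rule,
   and [K m] is the maximum over [[0, t]] of the summed norms of the partial derivatives. *)
apply: (@gronwall0 _ N (fun r => dot (- 'd s (c r) (e r)) (e r) +
   dot (e r) (- 'd s (c r) (e r))) (8 * K m)) => //.
- by rewrite /N /e /c /c' !great_circle0 subrr dot0l.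
- exact: dot_ge0.
- by move=> r _; exact: is_derive_dot.
- move=> r rt; have Kr : K r <= K m by apply: mP; rewrite in_itv.
  rewrite (dotC (e r)).
  have h1 : dot (- 'd s (c r) (e r)) (e r) <= 4 * K r * `|e r| ^+ 2.
    apply: (le_trans (dot_le_norm _ _)); rewrite normrN expr2 [leRHS]mulrA.
    apply: ler_wpM2r => //; rewrite -[leRHS]mulrA; apply: ler_wpM2l => //.
    rewrite dhext_sum// /K mulr_suml; apply: (le_trans (ler_norm_sum _ _ _)).
    by apply: ler_sum => k _; rewrite normrZ mulrC ler_wpM2l// row_coord_le.
  have K0 : 0 <= K r by apply: sumr_ge0.
  have h2 := ler_wpM2l K0 (coord_sqr_le_dot (e r)).
  have h3 := ler_wpM2r (dot_ge0 (e r)) Kr.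
  have h4 := le_trans h2 h3.
  have h5 : dot (- 'd s (c r) (e r)) (e r) <= 4 * (K m * dot (e r) (e r)).
    by apply: (le_trans h1); rewrite -mulrA ler_pM2l.
  apply: (le_trans (lerD h5 h5)).
  have E8 : 8 * K m * dot (e r) (e r) =
     4 * (K m * dot (e r) (e r)) + 4 * (K m * dot (e r) (e r)) by ring.
  by rewrite /N E8.
Qed.

Variable lam : E -> R.
Hypothesis slam : smooth_on_S3 (W := R^o) lam.
Hypothesis Xlam : forall A B : E -> E, vector_field A -> vector_field B ->
  orthogonal_fields X A -> orthogonal_fields X B ->
  forall x, S3 x -> lie_metric X A B x = lam x * dot (A x) (B x).

(** Projections of constant vectors to the planes normal to [y] and [X y]: admissible test fields
    with any prescribed normal value at a point. *)
Definition normal_field a y : E := a - dot a y *: y - dot a (X y) *: X y.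

Lemma normal_field_vector_field a : vector_field (normal_field a).
Proof.
have [[sX tX] uX] := XU; split; last first.
  move=> x xS; rewrite /normal_field !dotBl !dotZl tX//.
  by have -> : dot x x = 1 := xS; ring.
move=> x xS; have [U [F [oU Ux sF FX]]] := sX x xS.
exists U, (fun y => a + ((dot (- a) y : R) *: y + (dot (- a) (F y) : R) *: F y)); split=> //.
  move=> k; apply: Ck_on_add => //; first exact: Ck_on_cst.
  apply: Ck_on_add => //.
    by apply: Ck_on_scale => //; [apply: Ck_on_dot_cst => //|]; exact: Ck_on_id.
  by apply: Ck_on_scale => //; apply: Ck_on_dot_cst.
by move=> y Uy yS; rewrite FX// /normal_field !dotNl !scaleNr -addrA -opprD.
Qed.

Lemma normal_field_orthogonal a : orthogonal_fields X (normal_field a).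
Proof.
have [[sX tX] uX] := XU; move=> x xS.
by rewrite /normal_field !dotBr !dotZr tX// uX// (dotC a (X x)); ring.
Qed.

(** The shear-free condition tested on projected constants; the extra terms come from [ds
    (normal_field c x) = ds c + <c, s x> x]. As [a] and [b] are arbitrary and fixed, the identity
    can be differentiated in [x]. *)
Lemma shear_free_identity x a b : S3 x ->
  dot ('d s x a) b + dot ('d s x b) a + dot b x * dot a (s x) + dot a x * dot b (s x)
  = lam x * (dot a b - dot a x * dot b x - dot a (s x) * dot b (s x)).
Proof.
move=> xS; have x0 := S3_neq0 xS.
have := Xlam (normal_field_vector_field a) (normal_field_vector_field b)
  (normal_field_orthogonal a) (normal_field_orthogonal b) xS.
have sA c : smooth_on_S3 (normal_field c) by case: (normal_field_vector_field c).
rewrite lie_metricE// !dS3_hextE//; try exact: unit_field_smooth.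
have dF c : 'd s x (normal_field c x) = 'd s x c + dot c (s x) *: x.
  rewrite /normal_field -(hext_S3 X xS) !linearB/= !linearZ/= Xg//.
  by rewrite (dhext_radial XU)// oppr0 scaler0 addr0 opprK.
rewrite !dF /normal_field -(hext_S3 X xS).
rewrite !(dotDl, dotDr, dotNl, dotNr, dotZl, dotZr) /=.
have xx : dot x x = 1 := xS.
have sx : dot (s x) x = 0 := dot_hext XU x0.
have xs : dot x (s x) = 0 by rewrite dotC.
have ss : dot (s x) (s x) = 1 := dot_hext_hext XU x0.
have dx c : dot ('d s x c) x = - dot c (s x) by rewrite (dot_dhext XU)// dotC.
have xd c : dot x ('d s x c) = - dot c (s x) by rewrite dotC.
have dS c : dot ('d s x c) (s x) = 0 := dot_dhext_hext XU c x0.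
have Sd c : dot (s x) ('d s x c) = 0 by rewrite dotC.
rewrite !xx !sx !xs !ss !dx !xd !dS !Sd ?(dotC x a) ?(dotC x b) ?(dotC (s x) a) ?(dotC (s x) b).
rewrite (dotC a ('d s x b)).
move: (dot ('d s x a) b) (dot ('d s x b) a) (dot a x) (dot b x) (dot a (s x))
  (dot b (s x)) (dot a b) (lam x) => dab dba ax bx as_ bs ab l H.
by move: H; lra.
Qed.

(** * Second derivatives of the field and the Codazzi equation *)

Definition d2s x v w : E := 'd (fun z => 'D_v s z) x w.

Lemma differentiable_dhext x v : x != 0 -> differentiable (fun z => 'D_v s z) x.
Proof.
by move=> x0; apply: differentiable_derive_homogeneous_ext => //; exact: unit_field_smooth.
Qed.

Lemma d2s_sym x v w : x != 0 -> d2s x v w = d2s x w v.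
Proof.
move=> x0; rewrite /d2s.
have nd : \forall z \near x, differentiable s z.
  by apply: filterS (near_neq0 x0) => z; exact: differentiable_hext.
have dv := differentiable_dhext v x0; have dw := differentiable_dhext w x0.
exact: etrans (esym (deriveE _ dv)) (etrans (derive_row_comm nd dv dw) (deriveE _ dw)).
Qed.

Lemma is_derive_dhext_curve (c : R -> E) t a v : c t != 0 -> is_derive t 1 c v ->
  is_derive t 1 (fun r => 'd s (c r) a) (d2s (c t) a v).
Proof.
move=> c0 hc; have h := is_derive_chain (differentiable_dhext a c0) hc.
have nc : \forall r \near t, c r != 0.
  have cc : c @ t --> c t.
    exact: differentiable_continuous (is_derive_differentiable hc).
  exact: (cvgr_neq0 _ cc c0).
apply: near_eq_is_derive h; apply: filterS nc => r cr /=.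
by rewrite deriveE//; exact: differentiable_hext.
Qed.

(** The derivative of [shear_free_identity] along the great circle leaving [x] in direction [w]. In
    each product of two inner products both factors vanish at [x], so only the derivative [l] of
    [lam] survives on the right. *)
Lemma shear_free_identity_derive x w : S3 x -> S3 w -> dot x w = 0 ->
  exists l : R, forall a b,
    dot a x = 0 -> dot b x = 0 -> dot a (s x) = 0 -> dot b (s x) = 0 ->
    dot (d2s x a w) b + dot (d2s x b w) a = l * dot a b.
Proof.
move=> xS wS xw; have x0 := S3_neq0 xS.
pose c := great_circle x w.
have c0 : c 0 = x := great_circle0 x w.
have cS r : S3 (c r) by exact: great_circle_S3.
have hc : is_derive (0 : R) 1 c w.
  by apply: (is_derive_eq (is_derive_great_circle x w 0)); rewrite great_circle0.
have cn0 : c 0 != 0 by rewrite c0.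
have hs := is_derive_hext_curve XU cn0 hc.
have dl : differentiable (lam \o @radial_proj R : E -> R^o) (c 0).
  by apply: differentiable_homogeneous_ext.
have hl := is_derive_chain dl hc.
set l := 'd _ (c 0) w in hl; exists l => a b ax bx as_ bs.
have ha := is_derive_dhext_curve a cn0 hc.
have hb := is_derive_dhext_curve b cn0 hc.
have k u := is_derive_const (u : E) (0 : R) (1 : R).
have kR u := is_derive_const (u : R) (0 : R) (1 : R).
have HL := is_derive_add (is_derive_add (is_derive_add (is_derive_dot ha (k b)) (is_derive_dot hb (k a)))
  (is_derive_mul (is_derive_dot (k b) hc) (is_derive_dot (k a) hs)))
  (is_derive_mul (is_derive_dot (k a) hc) (is_derive_dot (k b) hs)).
have HR := is_derive_mul hl (is_derive_sub (is_derive_sub (kR (dot a b))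
  (is_derive_mul (is_derive_dot (k a) hc) (is_derive_dot (k b) hc)))
  (is_derive_mul (is_derive_dot (k a) hs) (is_derive_dot (k b) hs))).
have [_ EL] := HL; have [_ ER] := HR.
move: EL ER; set f := (fun _ : R => _); set g := (fun _ : R => _) => EL ER.
have fg : f = g.
  rewrite funeqE => r; rewrite /f /g /= radial_proj_id; last exact: cS.
  exact: shear_free_identity.
move: EL; rewrite fg ER /= !c0 !dot0l !dot0r.
rewrite ax bx as_ bs !(add0r, mulr0, mul0r, addr0, subr0, oppr0) => <-.
by [].
Qed.

Lemma is_derive_dhext x a w : x != 0 ->
  is_derive x w (fun z => 'd s z a) (d2s x a w).
Proof.
move=> x0; have da := differentiable_dhext a x0.
have h : is_derive x w (fun z => 'D_a s z) (d2s x a w).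
  by rewrite /d2s -deriveE//; exact/derivableP/diff_derivable.
apply: near_eq_is_derive h; apply: filterS (near_neq0 x0) => z z0.
by rewrite deriveE//; exact: differentiable_hext.
Qed.

(** The derivative of [<ds w, s> = 0]; [d2s_dot_pos] comes in the same way from
    [<ds w, x> = - <s, w>]. *)
Lemma d2s_dot_hext x w : x != 0 -> dot (d2s x w w) (s x) = - dot ('d s x w) ('d s x w).
Proof.
move=> x0; have h := is_derive_dot (is_derive_dhext w w x0) (is_derive_hext_at XU w x0).
apply/eqP; rewrite -addr_eq0; apply/eqP.
by apply: near_constant_derive _ x0 h => z z0; exact: (dot_dhext_hext XU).
Qed.

Lemma d2s_dot_pos x w : x != 0 -> dot (d2s x w w) x = - (2 * dot ('d s x w) w).
Proof.
move=> x0.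
have h := is_derive_add
  (is_derive_dot (is_derive_dhext w w x0) (is_derive_id x w))
  (is_derive_dot (is_derive_hext_at XU w x0) (is_derive_const w x w)).
have H : dot (d2s x w w) x + dot ('d s x w) w + (dot ('d s x w) w + dot (s x) 0) = 0.
  apply: near_constant_derive _ x0 h => z z0.
  by rewrite (dot_dhext XU)// addNr.
rewrite dot0r addr0 -addrA in H.
by apply/eqP; rewrite -addr_eq0 mulr_natl mulr2n; apply/eqP.
Qed.

(* The trace of the second derivative over the normal plane has no normal
   component: this is the Codazzi equation, and here is where the symmetry of
   second derivatives enters. *)
Lemma d2s_trace_normal x w1 w2 : S3 x -> S3 w1 -> S3 w2 -> dot w1 w2 = 0 ->
  dot w1 x = 0 -> dot w2 x = 0 -> dot w1 (s x) = 0 -> dot w2 (s x) = 0 ->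
  dot (d2s x w1 w1 + d2s x w2 w2) w1 = 0.
Proof.
move=> xS w1S w2S w12 w1x w2x w1s w2s; have x0 := S3_neq0 xS.
have xw1 : dot x w1 = 0 by rewrite dotC.
have xw2 : dot x w2 = 0 by rewrite dotC.
have [l1 H1] := shear_free_identity_derive xS w1S xw1.
have [l2 H2] := shear_free_identity_derive xS w2S xw2.
have e11 := H1 w1 w1 w1x w1x w1s w1s.
have e22 := H1 w2 w2 w2x w2x w2s w2s.
have e12 := H2 w1 w2 w1x w2x w1s w2s.
have n1 : dot w1 w1 = 1 := w1S.
have n2 : dot w2 w2 = 1 := w2S.
(* Write [D] for [d2s X x]. [e11] and [e22] equate [<D w1 w1, w1>] with [<D w2 w1, w2>]; by symmetry
   the latter is [<D w1 w2, w2>], which [e12] turns into [- <D w2 w2, w1>]. *)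
rewrite (d2s_sym w2 w1 x0) n2 in e22; rewrite n1 in e11; rewrite w12 in e12.
by rewrite dotDl; lra.
Qed.

End GeodesicUnitField.

(** * Orthonormal frames and (anti-)self-dual forms *)

Section Frames.
Variable R : realType.
Local Notation E := 'rV[R]_4.
Implicit Types (a b c d x y w X Y : E) (e : R).

Definition rows4 a b c d : 'M[R]_4 := \matrix_(i, j) (nth 0 [:: a; b; c; d] i) ord0 j.

Definition vol a b c d : R := \det (rows4 a b c d).

Local Notation "a ~_ k" := (a ord0 (inord k)) (at level 2, k at level 0).

(** The Pluecker coordinates of [a /\ b]. *)
Definition minor2 a b i j : R := a ~_i * b ~_j - b ~_i * a ~_j.

Lemma dotE a b : dot a b = a ~_0 * b ~_0 + a ~_1 * b ~_1 + a ~_2 * b ~_2 + a ~_3 * b ~_3.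
Proof. by rewrite /dot sum4. Qed.

(** Entries indexed by [nat] keep the minors in the same shape, so the expansion can be iterated;
    [bump j] skips the deleted column. *)
Lemma det_expand n (F : nat -> nat -> R) :
  \det (\matrix_(i < n.+1, j < n.+1) F i j) =
  \sum_(j < n.+1) F 0%N j * ((-1) ^+ j *
    \det (\matrix_(i < n, k < n) F i.+1 (bump j k))).
Proof.
rewrite (expand_det_row _ ord0); apply: eq_bigr => j _; rewrite mxE /cofactor.
congr (_ * (_ * \det _)).
by apply/matrixP => i k; rewrite !mxE.
Qed.

Lemma det2_expand (F : nat -> nat -> R) :
  \det (\matrix_(i < 2, j < 2) F i j) =
  F 0%N 0%N * F 1%N 1%N - F 0%N 1%N * F 1%N 0%N.
Proof.
rewrite (det_expand 1 F) !big_ord_recl big_ord0 !det_mx11 !mxE /= /bump /=.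
rewrite !addn0; ring.
Qed.

Lemma det3_expand (F : nat -> nat -> R) :
  let m i j := F 1%N i * F 2%N j - F 1%N j * F 2%N i in
  \det (\matrix_(i < 3, j < 3) F i j) =
  F 0%N 0%N * m 1%N 2%N - F 0%N 1%N * m 0%N 2%N + F 0%N 2%N * m 0%N 1%N.
Proof.
move=> m; rewrite (det_expand 2 F) !big_ord_recl big_ord0.
rewrite (det2_expand (fun i k => F i.+1 (bump 0 k))).
rewrite (det2_expand (fun i k => F i.+1 (bump 1 k))).
rewrite (det2_expand (fun i k => F i.+1 (bump 2 k))).
rewrite /m /bump /= !addn0 ?addn1 ?add1n; ring.
Qed.

(** Laplace expansion along the first two rows: the wedge pairing of the bivectors [a /\ b] and
    [c /\ d]. *)
Lemma volE a b c d : vol a b c d =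
  minor2 a b 0 1 * minor2 c d 2 3 - minor2 a b 0 2 * minor2 c d 1 3
  + minor2 a b 0 3 * minor2 c d 1 2 + minor2 a b 1 2 * minor2 c d 0 3
  - minor2 a b 1 3 * minor2 c d 0 2 + minor2 a b 2 3 * minor2 c d 0 1.
Proof.
pose F i j := (nth 0 [:: a; b; c; d] i) ord0 (inord j).
rewrite /vol; have -> : rows4 a b c d = \matrix_(i < 4, j < 4) F i j.
  by apply/matrixP => i j; rewrite !mxE /F inord_val.
rewrite (det_expand 3 F) !big_ord_recl big_ord0.
rewrite (det3_expand (fun i k => F i.+1 (bump 0 k))).
rewrite (det3_expand (fun i k => F i.+1 (bump 1 k))).
rewrite (det3_expand (fun i k => F i.+1 (bump 2 k))).
rewrite (det3_expand (fun i k => F i.+1 (bump 3 k))).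
rewrite /F /minor2 /bump /= ?addn0 ?add1n; ring.
Qed.

Lemma vol_swap a b c d : vol a b c d = vol c d a b.
Proof. rewrite !volE /minor2; ring. Qed.

Lemma row_rows4 v a b c d (j : 'I_4) : (v *m (rows4 a b c d)^T) ord0 j =
  dot v (nth 0 [:: a; b; c; d] j).
Proof. by rewrite mxE; apply: eq_bigr => i _; rewrite !mxE. Qed.

Lemma mul_rows4 v a b c d : v *m rows4 a b c d =
  v ~_0 *: a + v ~_1 *: b + v ~_2 *: c + v ~_3 *: d.
Proof. by apply/rowP => j; rewrite mxE sum4 !mxE !inordK. Qed.

Lemma rows4_mul a b c d (N : 'M[R]_4) :
  rows4 a b c d *m N = rows4 (a *m N) (b *m N) (c *m N) (d *m N).
Proof.
apply/matrixP => i j; rewrite mxE [RHS]mxE; move: i; apply: ord4P;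
  by rewrite inordK//= mxE; apply: eq_bigr => k _; rewrite mxE inordK.
Qed.

(** A determinant with a zero row vanishes, and a kernel vector is orthogonal to the other three
    rows. *)
Lemma exists_unit_orthogonal a b c :
  exists w, [/\ S3 w, dot w a = 0, dot w b = 0 & dot w c = 0].
Proof.
have : vol a b c 0 == 0 by rewrite volE /minor2 !mxE; apply/eqP; ring.
rewrite /vol -det_tr => /det0P[v v0 va].
have h j : dot v (nth 0 [:: a; b; c; 0] (j : 'I_4)) = 0.
  by rewrite -row_rows4 va mxE.
have hr u : dot v u = 0 -> dot (radial_proj v) u = 0.
  by rewrite /radial_proj dotZl => ->; rewrite mulr0.
exists (radial_proj v); split; first exact: radial_proj_S3.
- by apply: hr; have := h (inord 0); rewrite inordK.
- by apply: hr; have := h (inord 1); rewrite inordK.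
- by apply: hr; have := h (inord 2); rewrite inordK.
Qed.

Lemma vol0_dependent a b c d : vol a b c d = 0 ->
  exists r0 r1 r2 r3 : R, r0 *: a + r1 *: b + r2 *: c + r3 *: d = 0 /\
    ~ (r0 = 0 /\ r1 = 0 /\ r2 = 0 /\ r3 = 0).
Proof.
move=> /eqP /det0P[v v0 va].
exists (v ~_0), (v ~_1), (v ~_2), (v ~_3); split; first by rewrite -mul_rows4.
move=> [e0 [e1 [e2 e3]]]; move/eqP : v0; apply.
by apply/rowP; apply: ord4P; rewrite mxE.
Qed.

Definition frame f0 f1 f2 f3 := rows4 f0 f1 f2 f3 *m (rows4 f0 f1 f2 f3)^T = 1%:M
  /\ vol f0 f1 f2 f3 = 1.

Lemma rows4_orthonormal f0 f1 f2 f3 : S3 f0 -> S3 f1 -> S3 f2 -> S3 f3 ->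
  dot f0 f1 = 0 -> dot f0 f2 = 0 -> dot f0 f3 = 0 -> dot f1 f2 = 0 ->
  dot f1 f3 = 0 -> dot f2 f3 = 0 ->
  rows4 f0 f1 f2 f3 *m (rows4 f0 f1 f2 f3)^T = 1%:M.
Proof.
rewrite /S3/= => h00 h11 h22 h33 h01 h02 h03 h12 h13 h23.
have e i j : (rows4 f0 f1 f2 f3 *m (rows4 f0 f1 f2 f3)^T) i j =
   dot (nth 0 [:: f0; f1; f2; f3] i) (nth 0 [:: f0; f1; f2; f3] j).
  by rewrite mxE; apply: eq_bigr => k _; rewrite !mxE.
apply/matrixP; apply: ord4P; apply: ord4P; rewrite e !mxE -val_eqE/= !inordK//= ?h00 ?h11 ?h22 ?h33
  ?h01 ?h02 ?h03 ?h12 ?h13 ?h23// dotC ?h01 ?h02 ?h03 ?h12 ?h13 ?h23//.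
Qed.

Lemma frame_dot f0 f1 f2 f3 : frame f0 f1 f2 f3 ->
  [/\ S3 f0, S3 f1, S3 f2 & S3 f3] /\
  [/\ dot f0 f1 = 0, dot f0 f2 = 0, dot f0 f3 = 0 &
    [/\ dot f1 f2 = 0, dot f1 f3 = 0 & dot f2 f3 = 0]].
Proof.
case=> F _.
have e i j : dot (nth 0 [:: f0; f1; f2; f3] (i : 'I_4)) (nth 0 [:: f0; f1; f2; f3] (j : 'I_4))
   = (i == j)%:R.
  have := congr1 (fun M : 'M[R]_4 => M i j) F; rewrite !mxE => <-.
  by apply: eq_bigr => k _; rewrite !mxE.
have e' i j : (i < 4)%N -> (j < 4)%N ->
    dot (nth 0 [:: f0; f1; f2; f3] i) (nth 0 [:: f0; f1; f2; f3] j) = (i == j)%:R.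
  by move=> i4 j4; exact: (e (Ordinal i4) (Ordinal j4)).
split; split.
- exact: (e' 0 0)%N. - exact: (e' 1 1)%N. - exact: (e' 2 2)%N. - exact: (e' 3 3)%N.
- exact: (e' 0 1)%N. - exact: (e' 0 2)%N. - exact: (e' 0 3)%N.
- by split; [exact: (e' 1 2)%N | exact: (e' 1 3)%N | exact: (e' 2 3)%N].
Qed.

Lemma frame_completion x y : S3 x -> S3 y -> dot x y = 0 ->
  exists w1 w2, frame x y w1 w2.
Proof.
move=> xS yS xy.
have [w1 [w1S w1x w1y _]] := exists_unit_orthogonal x y 0.
have [w2 [w2S w2x w2y w21]] := exists_unit_orthogonal x y w1.
have F e : e ^+ 2 = 1 ->
    rows4 x y w1 (e *: w2) *m (rows4 x y w1 (e *: w2))^T = 1%:M.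
  move=> e2; apply: rows4_orthonormal; rewrite ?dotZr; try by rewrite // dotC ?mulr0.
  - by rewrite /S3/= dotZl dotZr mulrA -expr2 e2 mul1r.
  - by rewrite dotC w2x mulr0.
  - by rewrite dotC w2y mulr0.
  - by rewrite dotC w21 mulr0.
have volN : vol x y w1 (-1 *: w2) = - vol x y w1 w2.
  rewrite !volE /minor2 !mxE; ring.
have F1 := F 1 (expr1n _ _); rewrite scale1r in F1.
have : vol x y w1 w2 ^+ 2 = 1.
  by have := congr1 determinant F1; rewrite det_mulmx det_tr det1 expr2.
move/eqP; rewrite sqrf_eq1 => /orP[/eqP v1|/eqP v1]; exists w1.
  by exists w2.
by exists (-1 *: w2); split; [apply: F; rewrite sqrrN expr1n | rewrite volN v1 opprK].
Qed.

Section InFrame.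
Variables f0 f1 f2 f3 : E.
Hypothesis F : frame f0 f1 f2 f3.
Let M := rows4 f0 f1 f2 f3.

Lemma frame_parseval a b : dot a b =
  dot a f0 * dot b f0 + dot a f1 * dot b f1 + dot a f2 * dot b f2 + dot a f3 * dot b f3.
Proof.
have [FF _] := F; have MM := mulmx1C FF.
have -> : dot a b = dot (a *m M^T) (b *m M^T).
  by rewrite dot_mulmx trmxK -mulmxA MM mulmx1.
by rewrite dotE !row_rows4 !inordK.
Qed.

Lemma frame_expand a :
  a = dot a f0 *: f0 + dot a f1 *: f1 + dot a f2 *: f2 + dot a f3 *: f3.
Proof.
by apply: dot_ext => b; rewrite frame_parseval !dotDl !dotZl !(dotC b).
Qed.

Lemma vol_frame a b c d : vol a b c d =
  vol (a *m M^T) (b *m M^T) (c *m M^T) (d *m M^T).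
Proof.
have [_ v1] := F.
by rewrite /vol -rows4_mul det_mulmx det_tr -/(vol f0 f1 f2 f3) v1 mulr1.
Qed.

End InFrame.

(* The matrix of [a, b |-> <a /\ b, X /\ Y + e * star (X /\ Y)>]; for e = 1 and
   e = -1 it is self-dual and anti-self-dual, respectively. *)
Definition dual_mx e X Y : 'M[R]_4 :=
  let m i j := minor2 X Y i j in
  \matrix_(i, j) nth 0 (nth [::]
   [:: [:: 0; m 0 1 + e * m 2 3; m 0 2 - e * m 1 3; m 0 3 + e * m 1 2];
       [:: - (m 0 1 + e * m 2 3); 0; m 1 2 + e * m 0 3; m 1 3 - e * m 0 2];
       [:: - (m 0 2 - e * m 1 3); - (m 1 2 + e * m 0 3); 0; m 2 3 + e * m 0 1];
       [:: - (m 0 3 + e * m 1 2); - (m 1 3 - e * m 0 2); - (m 2 3 + e * m 0 1); 0]] i) j.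

Lemma dual_mxE e X Y a b : dot (a *m dual_mx e X Y) b =
  dot a X * dot b Y - dot a Y * dot b X + e * vol a b X Y.
Proof.
rewrite volE !dotE !mxE !sum4 !mxE !inordK//= /minor2; ring.
Qed.

Lemma dual_mx_anti e X Y a b : dot (a *m dual_mx e X Y) b = - dot (b *m dual_mx e X Y) a.
Proof. rewrite !dual_mxE !volE /minor2; ring. Qed.

(** Self-duality ([e = 1]) or anti-self-duality ([e = - 1]) can be expressed in any positive frame,
    so three coordinates determine the form, and they form a point of the unit sphere S^2. *)
Lemma dual_mx_frame e X Y f0 f1 f2 f3 : frame f0 f1 f2 f3 -> e ^+ 2 = 1 ->
  S3 X -> S3 Y -> dot X Y = 0 ->
  let P a b := dot (a *m dual_mx e X Y) b in
  [/\ P f2 f3 = e * P f0 f1, P f1 f3 = - e * P f0 f2, P f1 f2 = e * P f0 f3 &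
    P f0 f1 ^+ 2 + P f0 f2 ^+ 2 + P f0 f3 ^+ 2 = 1].
Proof.
move=> F e2 XS YS XY P.
have [[h00 h11 h22 h33] [h01 h02 h03 [h12 h13 h23]]] := frame_dot F.
have XX : dot X X = 1 := XS; have YY : dot Y Y = 1 := YS.
rewrite (frame_parseval F) in XX; rewrite (frame_parseval F) in YY.
rewrite (frame_parseval F) in XY.
rewrite /S3/= in h00 h11 h22 h33.
have v a b : P a b = dot a X * dot b Y - dot a Y * dot b X +
    e * vol (a *m (rows4 f0 f1 f2 f3)^T) (b *m (rows4 f0 f1 f2 f3)^T)
     (X *m (rows4 f0 f1 f2 f3)^T) (Y *m (rows4 f0 f1 f2 f3)^T).
  by rewrite /P dual_mxE (vol_frame F).
rewrite !v !volE /minor2 !row_rows4 !inordK//= h00 h11 h22 h33.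
rewrite (dotC f1 f0) (dotC f2 f0) (dotC f3 f0) (dotC f2 f1) (dotC f3 f1) (dotC f3 f2).
rewrite h01 h02 h03 h12 h13 h23 !(dotC _ X) !(dotC _ Y).
move: (dot X f0) (dot X f1) (dot X f2) (dot X f3) (dot Y f0) (dot Y f1) (dot Y f2)
  (dot Y f3) XX YY XY => X0 X1 X2 X3 Y0 Y1 Y2 Y3 XX YY XY {P v}.
have sub_e2 (l r g : R) : l - r = (1 - e ^+ 2) * g -> l = r.
  by rewrite e2 subrr mul0r => /eqP; rewrite subr_eq0 => /eqP.
split.
- apply: (sub_e2 _ _ (X2 * Y3 - Y2 * X3)); ring.
- apply: (sub_e2 _ _ (X1 * Y3 - Y1 * X3)); ring.
- apply: (sub_e2 _ _ (X1 * Y2 - Y1 * X2)); ring.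
(* The mixed terms are [2 e] times the Pluecker relation and vanish; what remains is Lagrange's
   identity for [X] and [Y]. *)
transitivity ((X0*Y1-Y0*X1)^+2 + (X0*Y2-Y0*X2)^+2 + (X0*Y3-Y0*X3)^+2 +
  e^+2 * ((X2*Y3-Y2*X3)^+2 + (X1*Y3-Y1*X3)^+2 + (X1*Y2-Y1*X2)^+2)); first ring.
transitivity ((X0 * X0 + X1 * X1 + X2 * X2 + X3 * X3) *
  (Y0 * Y0 + Y1 * Y1 + Y2 * Y2 + Y3 * Y3)
  - (X0 * Y0 + X1 * Y1 + X2 * Y2 + X3 * Y3) ^+ 2).
  by rewrite e2; ring.
by rewrite XX YY XY; ring.
Qed.

End Frames.

(** * Disjointness of leaves and the sign of the twist *)

Section RealAux.
Variable R : realType.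

(** A full turn is added to make [t] positive, since [hext_great_circle_ge0] covers positive
    times. *)
Lemma unit_circle_polar (A B : R) : A ^+ 2 + B ^+ 2 = 1 ->
  exists t : R, [/\ 0 < t, A = cos t & B = sin t].
Proof.
move=> AB.
have A1 : -1 <= A <= 1.
  by rewrite -ler_norml -(ler_pXn2r (ltn0Sn 1)) ?nnegrE// real_normK ?num_real// expr1n; have := sqr_ge0 B; lra.
have cA : cos (acos A) = A by rewrite acosK// in_itv.
have sA : sin (acos A) = `|B|.
  by rewrite sin_acos// (_ : 1 - A ^+ 2 = B ^+ 2) ?sqrtr_sqr//; lra.
have a0 := acos_ge0 A1; have api := acos_lepi A1; have pi0 := pi_gt0 R.
have [B0|B0] := leP 0 B.
  exists (acos A + pi *+ 2); split; last 2 first.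
  - by rewrite cosD2pi cA.
  - by rewrite sinD2pi sA ger0_norm.
  by rewrite ltr_wpDl// mulrn_wgt0.
exists (- acos A + pi *+ 2); split; last 2 first.
- by rewrite cosD2pi cosN cA.
- by rewrite sinD2pi sinN sA ltr0_norm// opprK.
by rewrite mulr2n; lra.
Qed.

Lemma derive_ge0_at_right (f : R -> R) (m : R) : f 0 = 0 ->
  (forall r : R, 0 < r -> 0 <= f r) -> is_derive (0 : R) 1 f m -> 0 <= m.
Proof.
move=> f0 fr hf; rewrite leNgt; apply/negP => m0.
have df := is_derive_differentiable hf.
have e0 : 0 < - m / 2 by rewrite divr_gt0// oppr_gt0.
have [d d0 dP] := differentiable_estimate df e0.
have d2 : 0 < d / 2 by rewrite divr_gt0.
have := dP (d / 2); rewrite gtr0_norm// addr0 f0 subr0.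
have -> : 'd f (0 : R) (d / 2 : R) = d / 2 * m.
  rewrite -[X in 'd f _ X]mulr1 -[d / 2 * 1]/(d / 2 *: (1 : R^o)) linearZ/=.
  by congr (_ * _); rewrite -deriveE//; case: hf.
move=> H; have {}H : `|f (d / 2) - d / 2 * m| <= - m / 2 * (d / 2).
  by apply: H; rewrite ltr_pdivrMr// mulr_natr mulr2n ltrDl.
have h1 := fr _ d2; have := le_trans (ler_norm _) H => h2.
have : d / 2 * m < 0 by rewrite pmulr_rlt0.
by move: h1 h2; set g := f (d / 2); lra.
Qed.

Lemma nonvanishing_same_sign (h : R -> R) : continuous h ->
  (forall t : R, 0 <= t <= 1 -> h t != 0) -> 0 < h 0 * h 1.
Proof.
move=> ch h0; rewrite ltNge; apply/negP => hneg.
have [|c c01 hc] := @IVT R h 0 1 0 ler01 (continuous_subspaceT ch).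
  rewrite ge_min le_max.
  have [a0|a0] := ltP (h 0) 0.
    apply/andP; split; apply/orP; [left; exact: ltW|right].
    by move: hneg; rewrite nmulr_rle0.
  have a0' : 0 < h 0 by rewrite lt_neqAle eq_sym h0 ?lexx ?ler01.
  apply/andP; split=> //; apply/orP; right.
  by move: hneg; rewrite pmulr_rle0.
by move: c01; rewrite in_itv/= => /h0; rewrite hc eqxx.
Qed.

End RealAux.

Section Leaves.
Variable R : realType.
Local Notation E := 'rV[R]_4.
Variable X : E -> E.
Hypothesis XU : unit_vector_field X.
Local Notation s := (hext X).
Implicit Types (x y v w : E) (t : R).
Hypothesis Xg : forall x, S3 x -> 'd s x (s x) = - x.

Lemma dot_leaf x A B : S3 x -> dot (A *: x + B *: s x) (A *: x + B *: s x) = A ^+ 2 + B ^+ 2.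
Proof.
move=> xS; have x0 := S3_neq0 xS.
have xx : dot x x = 1 := xS.
have sx : dot (s x) x = 0 := dot_hext XU x0.
have xs : dot x (s x) = 0 by rewrite dotC.
have ss : dot (s x) (s x) = 1 := dot_hext_hext XU x0.
rewrite !dotDl !dotDr !dotZl !dotZr xx sx xs ss; ring.
Qed.

Lemma hext_leaf x A B : S3 x -> A ^+ 2 + B ^+ 2 = 1 ->
  s (A *: x + B *: s x) = - B *: x + A *: s x.
Proof.
move=> xS /unit_circle_polar[t [t0 -> ->]].
have := hext_great_circle_ge0 XU Xg xS t0; rewrite /great_circle => ->.
by rewrite scalerN scaleNr addrC.
Qed.

(** A linear relation yields a nonzero [z] in both leaf planes. On each plane [s] turns [z] by a
    right angle up to normalization, so [z] and [s z] span both, and the planes coincide. *)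
Lemma vol0_same_leaf x y : S3 x -> S3 y -> vol y (s y) x (s x) = 0 ->
  exists A B, y = A *: x + B *: s x.
Proof.
move=> xS yS /vol0_dependent[r0 [r1 [r2 [r3 [E0 r_neq0]]]]].
pose z := r0 *: y + r1 *: s y.
have Ez : z = - r2 *: x + - r3 *: s x.
  apply/eqP; rewrite -subr_eq0 !scaleNr opprD !opprK /z addrA; exact/eqP.
have n1 : dot z z = r0 ^+ 2 + r1 ^+ 2 := dot_leaf r0 r1 yS.
have n2 : dot z z = r2 ^+ 2 + r3 ^+ 2 by rewrite Ez dot_leaf// !sqrrN.
have z0 : z != 0.
  apply/eqP => z0; apply: r_neq0; move: n1 n2; rewrite z0 dot0l => e1 e2.
  have sq0 (u v : R) : 0 = u ^+ 2 + v ^+ 2 -> u = 0 /\ v = 0.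
    move/esym/eqP; rewrite paddr_eq0 ?sqr_ge0// !sqrf_eq0.
    by move=> /andP[/eqP -> /eqP ->].
  by have [-> ->] := sq0 _ _ e1; have [-> ->] := sq0 _ _ e2.
pose n := inv_norm z; have n0 := inv_norm_gt0 z0; have nM := inv_normM z0.
have hz1 : s z = (n * - r1) *: y + (n * r0) *: s y.
  have -> : s z = s (n *: z) by rewrite /hext/= radial_projZ.
  rewrite /z scalerDr !scalerA hext_leaf//; first by rewrite mulrN.
  by rewrite !exprMn -mulrDr -n1.
have hz2 : s z = (n * r3) *: x + (n * - r2) *: s x.
  have -> : s z = s (n *: z) by rewrite /hext/= radial_projZ.
  rewrite Ez scalerDr !scalerA hext_leaf//; first by rewrite mulrN opprK.
  by rewrite !exprMn !sqrrN -mulrDr -n2.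
(* Solving for [y] in its own plane gives [y = n ^ 2 r0 z - n r1 s z]; substituting [z] and [s z] in
   terms of [x] and [s x] produces these coefficients. *)
exists (n * (n * (r0 * - r2)) - n * (r1 * (n * r3))), (n * (n * (r0 * - r3)) - n * (r1 * (n * - r2))).
have Ey : y = (n * n * r0) *: z - (n * r1) *: s z.
  rewrite {1}hz1 /z !scalerDr !scalerA opprD addrACA -!scalerBl.
  have -> : n * n * r0 * r0 - n * r1 * (n * - r1) = n ^+ 2 * (r0 ^+ 2 + r1 ^+ 2) by ring.
  have -> : n * n * r0 * r1 - n * r1 * (n * r0) = 0 by ring.
  by rewrite -n1 nM scale1r scale0r addr0.
rewrite {1}Ey hz2 {1}Ez !scalerDr !scalerA opprD addrACA -!scalerBl.
by congr (_ *: _ + _ *: _); ring.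
Qed.

Lemma vol_hext_continuous x y : y != 0 ->
  {for y, continuous (fun z => vol z (s z) x (s x) : R)}.
Proof.
move=> y0; apply: differentiable_continuous.
have -> : (fun z => vol z (s z) x (s x)) = (fun z =>
   dot (z *m dual_mx 1 x (s x)) (s z) - (dot z x * dot (s z) (s x) - dot z (s x) * dot (s z) x)).
  by rewrite funeqE => z; rewrite dual_mxE mul1r; ring.
have ds := differentiable_hext XU y0.
have cst (a : E) : differentiable (fun=> a) y by exact: differentiable_cst.
apply: differentiableB; first exact/differentiable_dot/ds/differentiable_mulmx.
by apply: differentiableB; apply: differentiable_mul; apply: differentiable_dot.
Qed.

(** * Constant sign of the volume off a leaf *)

Section Sign.
Variables x w1 w2 : E.
Hypothesis F : frame x (s x) w1 w2.

(** Coordinates off the leaf plane. The parameters with [r > 0] form a convex set, on which a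
    continuous nonvanishing function has constant sign. Points are not normalized, since [s] is
    defined off the sphere. *)
Definition polar_pt (A B r b : R) : E := A *: x + B *: s x + r *: (cos b *: w1 + sin b *: w2).

Lemma polar_pt_dot A B r b : dot (polar_pt A B r b) (cos b *: w1 + sin b *: w2) = r.
Proof.
have [[h00 h11 h22 h33] [h01 h02 h03 [h12 h13 h23]]] := frame_dot F.
have e2 : dot w1 w1 = 1 := h22; have e3 : dot w2 w2 = 1 := h33.
rewrite /polar_pt !(dotDl, dotDr, dotZl, dotZr) (dotC w2 w1) h02 h03 h12 h13 h23 e2 e3.
transitivity (r * (cos b ^+ 2 + sin b ^+ 2)); first ring.
by rewrite cos2Dsin2 mulr1.
Qed.

Definition polar_vol A B r b := let y := polar_pt A B r b in vol y (s y) x (s x).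

Lemma vol_scalel (k : R) (a b c d : E) : vol (k *: a) b c d = k * vol a b c d :> R.
Proof. rewrite !volE /minor2 !mxE; ring. Qed.

Lemma polar_pt_neq0 A B r b : 0 < r -> polar_pt A B r b != 0.
Proof.
move=> r0; apply/eqP => p0; have := polar_pt_dot A B r b.
by rewrite p0 dot0l => E0; rewrite E0 ltxx in r0.
Qed.

(** Otherwise the normalized point would lie on the leaf of [x] and be orthogonal to
    [cos b w1 + sin b w2], whereas that inner product is a positive multiple of [r]. *)
Lemma polar_vol_neq0 A B r b : 0 < r -> polar_vol A B r b != 0.
Proof.
move=> r0; have y0 := polar_pt_neq0 A B b r0; rewrite /polar_vol.
set y := polar_pt A B r b in y0 *; apply/eqP => v0.
have [[xS _ _ _] [h01 h02 h03 [h12 h13 h23]]] := frame_dot F.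
have pS := radial_proj_S3 y0.
have n0 := inv_norm_gt0 y0.
have v1 : vol (radial_proj y) (s (radial_proj y)) x (s x) = 0.
  rewrite (hext_S3 X pS) -[X (radial_proj y)]/(s y).
  by rewrite /radial_proj vol_scalel v0 mulr0.
have [A' [B' Ey]] := vol0_same_leaf xS pS v1.
have : dot (radial_proj y) (cos b *: w1 + sin b *: w2) = 0.
  rewrite Ey !(dotDl, dotDr, dotZl, dotZr) h02 h03 h12 h13; ring.
rewrite /radial_proj dotZl /y polar_pt_dot => /eqP; rewrite mulf_eq0.
by rewrite -/(inv_norm y) (gt_eqF n0) (gt_eqF r0).
Qed.

Lemma polar_vol_same_sign A B r b A' B' r' b' : 0 < r -> 0 < r' ->
  0 < polar_vol A B r b * polar_vol A' B' r' b'.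
Proof.
move=> r0 r'0.
pose l (u u' t : R) := u + t * (u' - u).
have cl u u' : continuous (l u u').
  move=> t; apply: cvgD; first exact: cvg_cst.
  by apply: cvgM; [exact: cvg_id | exact: cvg_cst].
(* The time is clamped since the radius may vanish outside [0, 1]. *)
pose t01 := clamp (0 : R) 1.
have l0 t : 0 < l r r' (t01 t).
  have := clampP t (@ler01 R); rewrite -/t01 => /andP[h0 h1]; rewrite /l.
  have [e0|e0] := eqVneq (t01 t) 0; first by rewrite e0 mul0r addr0.
  have e1 : 0 < t01 t * r' by rewrite mulr_gt0// lt_neqAle eq_sym e0.
  have e2 : 0 <= (1 - t01 t) * r by rewrite mulr_ge0 ?subr_ge0// ltW.
  by move: e1 e2; lra.
pose Y t := polar_pt (l A A' t) (l B B' t) (l r r' t) (l b b' t).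
have cY : continuous Y.
  move=> t; rewrite /Y /polar_pt.
  have cZ (f : R -> R) (u : E) : continuous f -> (fun t => f t *: u) @ t --> f t *: u.
    by move=> cf; apply: cvgZr_tmp; exact: cf.
  apply: cvgD; first by apply: cvgD; exact: cZ.
  apply: cvgZ; first exact: cl.
  apply: cvgD; apply: cZ => z.
    by apply: (@continuous_comp _ _ _ (l b b') cos); [exact: cl | exact: continuous_cos].
  by apply: (@continuous_comp _ _ _ (l b b') sin); [exact: cl | exact: continuous_sin].
have t010 : t01 0 = 0 by apply: clamp_id; rewrite lexx ler01.
have t011 : t01 1 = 1 by apply: clamp_id; rewrite lexx ler01.
have e0 u u' : l u u' (t01 0) = u by rewrite /l t010 mul0r addr0.
have e1 u u' : l u u' (t01 1) = u' by rewrite /l t011 mul1r addrC subrK.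
have := @nonvanishing_same_sign R (fun t => vol (Y (t01 t)) (s (Y (t01 t))) x (s x)).
rewrite /Y !e0 !e1; apply.
  move=> t; apply: (@continuous_comp _ _ _ (Y \o t01) (fun y => vol y (s y) x (s x))).
    by apply: continuous_comp; [exact: clamp_continuous | exact: cY].
  by apply: vol_hext_continuous; exact: polar_pt_neq0.
by move=> t _; exact: polar_vol_neq0.
Qed.

Lemma off_leaf_polar y : S3 y -> (forall A B, y <> A *: x + B *: s x) ->
  exists A B r b, 0 < r /\ y = polar_pt A B r b.
Proof.
move=> yS yL; have Ey := frame_expand F y.
set A := dot y x in Ey; set B := dot y (s x) in Ey.
set C := dot y w1 in Ey; set D := dot y w2 in Ey.
have CD : 0 < C ^+ 2 + D ^+ 2.
  rewrite lt_neqAle addr_ge0 ?sqr_ge0// andbT eq_sym; apply/eqP => /eqP.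
  rewrite paddr_eq0 ?sqr_ge0// !sqrf_eq0 => /andP[/eqP C0 /eqP D0].
  by apply: (yL A B); rewrite {1}Ey C0 D0 !scale0r !addr0.
pose r := Num.sqrt (C ^+ 2 + D ^+ 2).
have r0 : 0 < r by rewrite sqrtr_gt0.
have r2 : r ^+ 2 = C ^+ 2 + D ^+ 2 by rewrite sqr_sqrtr// ltW.
have [|b [_ cb sb]] := @unit_circle_polar R (C / r) (D / r).
  by rewrite !expr_div_n -mulrDl -r2 divff// expf_neq0// gt_eqF.
exists A, B, r, b; split=> //; rewrite {1}Ey /polar_pt -cb -sb scalerDr !scalerA.
by rewrite ![r * _]mulrC !divfK ?gt_eqF// addrA.
Qed.

Lemma vol_same_sign y y' : S3 y -> S3 y' ->
  (forall A B, y <> A *: x + B *: s x) -> (forall A B, y' <> A *: x + B *: s x) ->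
  0 < vol y (s y) x (s x) * vol y' (s y') x (s x).
Proof.
move=> yS yS' /(off_leaf_polar yS)[A [B [r [b [r0 ->]]]]].
move=> /(off_leaf_polar yS')[A' [B' [r' [b' [r'0 ->]]]]].
exact: polar_vol_same_sign.
Qed.

(** First-order form of the constant sign. At [c t = x + t w1] the volume is
    [t * vol w1 (s (c t)) x (s x)]; the second factor vanishes at [t = 0] with derivative
    [<ds w1, w2>], which therefore cannot oppose the common sign. *)
Lemma vol_sign_twist y : S3 y -> (forall A B, y <> A *: x + B *: s x) ->
  0 <= vol y (s y) x (s x) * dot ('d s x w1) w2.
Proof.
move=> yS /(off_leaf_polar yS)[A [B [r [b [r0 ->]]]]].
rewrite -/(polar_vol A B r b); set k := polar_vol A B r b.
have [[xS sS h22 h33] [h01 h02 h03 [h12 h13 h23]]] := frame_dot F.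
have x0 := S3_neq0 xS; have [_ v1] := F.
pose c (t : R) : E := x + t *: w1.
have hc : is_derive (0 : R) 1 c w1.
  have dl : differentiable ( *:%R^~ w1 : R -> E) (0 : R) by [].
  have h : is_derive (0 : R) 1 (fun t : R => t *: w1) w1.
    by split; [exact/derivable1_diffP | rewrite deriveE// diff_val scale1r].
  by apply: (is_derive_eq (is_derive_add (is_derive_const x (0 : R) 1) h)); rewrite add0r.
have c0 : c 0 = x by rewrite /c scale0r addr0.
have cn0 : c 0 != 0 by rewrite c0.
have volw u : vol w1 u x (s x) = dot (w1 *m dual_mx 1 x (s x)) u.
  by rewrite dual_mxE (dotC w1 x) (dotC w1 (s x)) h02 h12; ring.
pose phi t : R := k * vol w1 (s (c t)) x (s x).
have hphi : is_derive (0 : R) 1 phi (k * vol w1 ('d s x w1) x (s x)).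
  rewrite /phi; under eq_fun do rewrite volw.
  have h := is_derive_mul (is_derive_const (k : R) (0 : R) 1)
    (is_derive_dot (is_derive_const (w1 *m dual_mx 1 x (s x)) (0 : R) 1)
      (is_derive_hext_curve XU cn0 hc)).
  by apply: (is_derive_eq h); rewrite c0 volw dot0l mul0r !add0r.
have -> : dot ('d s x w1) w2 = vol w1 ('d s x w1) x (s x).
  rewrite volw {2}(frame_expand F ('d s x w1)) !dotDr !dotZr -!volw.
  have -> : vol w1 w2 x (s x) = 1 by rewrite vol_swap.
  have -> : vol w1 x x (s x) = 0 by rewrite volE /minor2; ring.
  have -> : vol w1 (s x) x (s x) = 0 by rewrite volE /minor2; ring.
  have -> : vol w1 w1 x (s x) = 0 by rewrite volE /minor2; ring.
  by ring.
apply: (derive_ge0_at_right _ _ hphi) => [|t t0].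
  rewrite /phi c0; have -> : vol w1 (s x) x (s x) = 0 by rewrite volE /minor2; ring.
  by rewrite mulr0.
have := polar_vol_same_sign A B b 1 0 0 r0 t0.
have ct : polar_pt 1 0 t 0 = c t.
  by rewrite /polar_pt /c cos0 sin0 !scale1r !scale0r !addr0.
rewrite /polar_vol -/(polar_vol A B r b) ct -/k.
have -> : vol (c t) (s (c t)) x (s x) = t * vol w1 (s (c t)) x (s x).
  rewrite !volE /minor2 /c !mxE; ring.
by rewrite mulrCA pmulr_rgt0// => /ltW.
Qed.

End Sign.

End Leaves.

(** * The maximum principle *)

Section MaximumAlgebra.
Variable R : realType.

Lemma second_derivative_at_max (k dk : R -> R) (m : R) :
  (forall t : R, is_derive t 1 k (dk t)) -> is_derive (0 : R) 1 dk m ->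
  (forall t, k t <= k 0) -> dk 0 = 0 /\ m <= 0.
Proof.
move=> hk hdk kmax.
have dk0 : dk 0 = 0.
  apply/eqP; rewrite eq_le; apply/andP; split.
    have h := is_derive_sub (is_derive_const (k 0) (0 : R) (1 : R)) (hk 0).
    have := derive_ge0_at_right (subrr _) _ h; rewrite sub0r oppr_ge0; apply.
    by move=> r _; rewrite subr_ge0; exact: kmax.
  have hN : is_derive (0 : R) 1 (fun r : R => - r) (-1).
    exact: is_derive_opp (is_derive_id (0 : R) (1 : R)).
  have dk0 : differentiable k (- (0 : R)) by apply: is_derive_differentiable (hk _).
  have hc := is_derive_chain dk0 hN.
  have h := is_derive_sub (is_derive_const (k 0) (0 : R) (1 : R)) hc.
  have -> : dk 0 = 0 - 'd k (- (0 : R)) (-1).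
    rewrite linearN/= sub0r opprK -deriveE//; have [_ <-] := hk 0; by rewrite oppr0.
  apply: (derive_ge0_at_right _ _ h); first by rewrite /= oppr0 subrr.
  by move=> r _; rewrite subr_ge0; exact: kmax.
split=> //; rewrite leNgt; apply/negP => m0.
have ddk := is_derive_differentiable hdk.
have e0 : 0 < m / 2 by rewrite divr_gt0.
have [d d0 dP] := differentiable_estimate ddk e0.
have dpos (t : R) : 0 < t -> t < d -> 0 < dk t.
  move=> t0 td; have := dP t; rewrite gtr0_norm// addr0 dk0 subr0.
  have -> : 'd dk (0 : R) (t : R) = t * m.
    rewrite -[X in 'd dk _ X]mulr1 -[t * 1]/(t *: (1 : R^o)) linearZ/=.
    by congr (_ * _); rewrite -deriveE//; case: hdk.
  move=> /(_ td); rewrite ler_norml => /andP[H _].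
  have := mulr_gt0 t0 m0; move: H; set u := dk t; lra.
have d2 : 0 < d / 2 by rewrite divr_gt0.
have [|c c02 E1] := MVT d2 (fun t _ => hk t).
  by apply: derivable_within_continuous => t _; case: (hk t).
move: c02; rewrite in_itv/= => /andP[c0 cd].
have cdd : c < d by apply: (lt_trans cd); rewrite ltr_pdivrMr// mulr_natr mulr2n ltrDl.
have := kmax (d / 2); rewrite -subr_le0 E1 subr0 leNgt => /negP; apply.
by rewrite mulr_gt0// dpos.
Qed.

(* With P = 1 - p, N = 1 + p, Q = 1 - q, this says that P^2 / (N^2 Q) has no
   critical maximum: the Laplacian of its logarithm is m > 0. *)
Lemma no_critical_maximum (p q h a1 a2 b1 b2 c1 c2 d1 d2 k m : R) :
  0 < 1 - p -> 0 < 1 + p -> 0 < 1 - q -> 0 < m ->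
  (1 - p) ^+ 2 = h * ((1 + p) ^+ 2 * (1 - q)) ->
  - 2 * (1 - p) * a1 - h * (2 * (1 + p) * a1 * (1 - q) - (1 + p) ^+ 2 * b1) = 0 ->
  - 2 * (1 - p) * a2 - h * (2 * (1 + p) * a2 * (1 - q) - (1 + p) ^+ 2 * b2) = 0 ->
  a1 ^+ 2 + a2 ^+ 2 = k * (1 - p ^+ 2) -> b1 ^+ 2 + b2 ^+ 2 = m * (1 - q ^+ 2) ->
  c1 + c2 = - 2 * k * p -> d1 + d2 = - 2 * m * q ->
  let K a b c d := 2 * a ^+ 2 - 2 * (1 - p) * c - h * (2 * a ^+ 2 * (1 - q)
    + 2 * (1 + p) * c * (1 - q) - 4 * (1 + p) * a * b - (1 + p) ^+ 2 * d) in
  K a1 b1 c1 d1 <= 0 -> K a2 b2 c2 d2 <= 0 -> False.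
Proof.
move=> P0 N0 Q0 m0 Eh F1 F2 Sa Sb Sc Sd K K1 K2.
have Pn : 1 - p != 0 by rewrite gt_eqF.
have Nn : 1 + p != 0 by rewrite gt_eqF.
have Qn : 1 - q != 0 by rewrite gt_eqF.
have hE : h = (1 - p) ^+ 2 / ((1 + p) ^+ 2 * (1 - q)).
  by rewrite Eh mulfK// mulf_neq0// expf_neq0.
(* Criticality of the logarithm: [q' / (1 - q) = 2 p' / (1 - p) + 2 p' / (1 + p)]. *)
have bE a b : - 2 * (1 - p) * a - h * (2 * (1 + p) * a * (1 - q) - (1 + p) ^+ 2 * b) = 0 ->
    b = 4 * a * (1 - q) / ((1 + p) * (1 - p)).
  move=> Fab.
  have -> : b = 4 * a * (1 - q) / ((1 + p) * (1 - p)) +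
    (- 2 * (1 - p) * a - h * (2 * (1 + p) * a * (1 - q) - (1 + p) ^+ 2 * b)) *
    ((1 - q) / (1 - p) ^+ 2) by rewrite hE; field; rewrite Pn Nn Qn.
  by rewrite Fab mul0r addr0.
have B1 := bE _ _ F1; have B2 := bE _ _ F2.
(* Inserting this into the two gradient equations ties [k] to [m]. *)
have kE : 16 * k * (1 - q) ^+ 2 / ((1 + p) * (1 - p)) = m * (1 - q ^+ 2).
  rewrite -Sb B1 B2.
  transitivity (16 * (a1 ^+ 2 + a2 ^+ 2) * (1 - q) ^+ 2 / ((1 + p) * (1 - p)) ^+ 2).
    rewrite Sa; field; by rewrite Pn Nn.
  by field; rewrite Pn Nn.
(* At a critical zero, the Laplacian of [(1 - p)^2 - h (1 + p)^2 (1 - q)] is [(1 - p)^2] times that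
   of the logarithm. *)
have : K a1 b1 c1 d1 + K a2 b2 c2 d2 = m * (1 - p) ^+ 2.
  transitivity (2 * (a1 ^+ 2 + a2 ^+ 2) - 2 * (1 - p) * (c1 + c2)
    - h * (2 * (a1 ^+ 2 + a2 ^+ 2) * (1 - q) + 2 * (1 + p) * (c1 + c2) * (1 - q)
    - 4 * (1 + p) * (a1 * b1 + a2 * b2) - (1 + p) ^+ 2 * (d1 + d2))).
    by rewrite /K; ring.
  have Sab : a1 * b1 + a2 * b2 = 4 * k * (1 - q).
    rewrite B1 B2.
    transitivity (4 * (a1 ^+ 2 + a2 ^+ 2) * (1 - q) / ((1 + p) * (1 - p))).
      by field; rewrite Pn Nn.
    by rewrite Sa; field; rewrite Pn Nn.
  rewrite Sab Sa Sc Sd hE.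
  transitivity ((16 * k * (1 - q) ^+ 2 / ((1 + p) * (1 - p))) * ((1 - p) ^+ 2 / (1 - q) ^+ 2)
     - 2 * m * q * (1 - p) ^+ 2 / (1 - q)).
    by field; rewrite Pn Nn Qn.
  by rewrite kE; field; rewrite Qn.
have : 0 < m * (1 - p) ^+ 2 by rewrite mulr_gt0// exprn_gt0.
by move: K1 K2; set u := K _ _ _ _; set v := K _ _ _ _; lra.
Qed.

(** With the denominator cleared, the barrier is polynomial in [p] and [q] and makes sense on the
    fixed leaf too. For [h] the maximal quotient it is nonpositive, and zero at the maximum. *)
Lemma is_derive_barrier (p q dp dq : R -> R) (t h : R) :
  is_derive t 1 p (dp t) -> is_derive t 1 q (dq t) ->
  is_derive t 1 (fun r => (1 - p r) * (1 - p r) - h * ((1 + p r) * (1 + p r) * (1 - q r)))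
   (- 2 * ((1 - p t) * dp t) - h * (2 * (1 + p t) * dp t * (1 - q t) - (1 + p t) * (1 + p t) * dq t)).
Proof.
move=> hp hq; have one := is_derive_const (1 : R) t (1 : R).
have hP := is_derive_sub one hp; have hN := is_derive_add one hp.
have hQ := is_derive_sub one hq.
have H := is_derive_sub (is_derive_mul hP hP) (is_derive_mul (is_derive_const (h : R) t (1 : R))
  (is_derive_mul (is_derive_mul hN hN) hQ)).
apply: (is_derive_eq H); ring.
Qed.

Lemma is_derive_barrier2 (p q dp dq : R -> R) (t h ddp ddq : R) :
  is_derive t 1 p (dp t) -> is_derive t 1 q (dq t) ->
  is_derive t 1 dp ddp -> is_derive t 1 dq ddq ->
  is_derive t 1 (fun r => - 2 * ((1 - p r) * dp r)
     - h * (2 * (1 + p r) * dp r * (1 - q r) - (1 + p r) * (1 + p r) * dq r))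
   (2 * dp t ^+ 2 - 2 * (1 - p t) * ddp - h * (2 * dp t ^+ 2 * (1 - q t)
    + 2 * (1 + p t) * ddp * (1 - q t) - 4 * (1 + p t) * dp t * dq t - (1 + p t) ^+ 2 * ddq)).
Proof.
move=> hp hq hdp hdq; have c a := is_derive_const (a : R) t (1 : R).
have hP := is_derive_sub (c 1) hp; have hN := is_derive_add (c 1) hp.
have hQ := is_derive_sub (c 1) hq.
have H := is_derive_sub (is_derive_mul (c (- 2)) (is_derive_mul hP hdp))
  (is_derive_mul (c h) (is_derive_sub
    (is_derive_mul (is_derive_mul (is_derive_mul (c 2) hN) hdp) hQ)
    (is_derive_mul (is_derive_mul hN hN) hdq))).
apply: (is_derive_eq H); ring.
Qed.

End MaximumAlgebra.

(** Positivity of the coefficient [m]; [- - e] appears because [q] is built with [- e] in place of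
    [e]. *)
Lemma sum_sqr_gt0 (R : realFieldType) (a b e : R) : e ^+ 2 = 1 -> 0 <= e * b ->
  0 < a ^+ 2 + (b - - e) ^+ 2.
Proof.
move=> e2 eb; have -> : a ^+ 2 + (b - - e) ^+ 2 = e ^+ 2 + (a ^+ 2 + b ^+ 2 + 2 * (e * b)) by ring.
by rewrite e2 ltr_pwDl// !addr_ge0 ?sqr_ge0// mulr_ge0.
Qed.

(** * Gradients and Laplacians of [p] and [q] *)

Section Laplacian.
Variable R : realType.
Local Notation E := 'rV[R]_4.
Variable X : E -> E.
Hypothesis XU : unit_vector_field X.
Local Notation s := (hext X).
Implicit Types (x y v w : E) (t : R).
Hypothesis Xg : forall x, S3 x -> 'd s x (s x) = - x.
Variable lam : E -> R.
Hypothesis slam : smooth_on_S3 (W := R^o) lam.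
Hypothesis Xlam : forall A B : E -> E, vector_field A -> vector_field B ->
  orthogonal_fields X A -> orthogonal_fields X B ->
  forall x, S3 x -> lie_metric X A B x = lam x * dot (A x) (B x).

(** The overview's [p] for [L = dual_mx e x0 (s x0)], and its [q] for [- e]. *)
Definition quad (L : 'M[R]_4) y : R := dot (y *m L) (s y).

Definition dquad (L : 'M[R]_4) x w t : R :=
  dot (great_circle w (- x) t *m L) (s (great_circle x w t)) +
  dot (great_circle x w t *m L)
    ('d s (great_circle x w t) (great_circle w (- x) t)).

Lemma is_derive_quad L x w t : S3 x -> S3 w -> dot x w = 0 ->
  is_derive t 1 (fun r => quad L (great_circle x w r)) (dquad L x w t).
Proof.
move=> xS wS xw; have c0 := S3_neq0 (great_circle_S3 t xS wS xw).
have hc := is_derive_great_circle x w t.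
exact: is_derive_dot (is_derive_mulmx L hc) (is_derive_hext_curve XU c0 hc).
Qed.

Lemma dquad0 L x w : dquad L x w 0 = dot (w *m L) (s x) + dot (x *m L) ('d s x w).
Proof. by rewrite /dquad !great_circle0. Qed.

Lemma is_derive_dquad L x w : S3 x -> S3 w -> dot x w = 0 ->
  is_derive (0 : R) 1 (dquad L x w)
    (- quad L x + 2 * dot (w *m L) ('d s x w) + dot (x *m L) (d2s X x w w)).
Proof.
move=> xS wS xw; have x0 := S3_neq0 xS.
pose c := great_circle x w; pose c' := great_circle w (- x).
have cn0 : c 0 != 0 by rewrite /c great_circle0.
have hc : is_derive (0 : R) 1 c w.
  by apply: (is_derive_eq (is_derive_great_circle x w 0)); rewrite great_circle0.
have hc' : is_derive (0 : R) 1 c' (- x).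
  by apply: (is_derive_eq (is_derive_great_circle w (- x) 0)); rewrite great_circle0.
have hw := is_derive_dhext_curve XU w cn0 hc.
have hx := is_derive_dhext_curve XU (- x) cn0 hc.
have hd := is_derive_add (is_derive_scale (is_derive_cos (0 : R)) hw)
  (is_derive_scale (is_derive_sin (0 : R)) hx).
have hs := is_derive_hext_curve XU cn0 hc.
have H := is_derive_add (is_derive_dot (is_derive_mulmx L hc') hs)
  (is_derive_dot (is_derive_mulmx L hc) hd).
(* The moving direction is split into the fixed vectors [w] and [- x], for which
   [is_derive_dhext_curve] applies; the second contributes nothing at 0 because [ds x x = 0]. *)
have -> : dquad L x w = (fun r => dot (c' r *m L) (s (c r)) +
    dot (c r *m L) (cos r *: 'd s (c r) w + sin r *: 'd s (c r) (- x))).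
  by rewrite funeqE => r; rewrite /dquad /c /c' [in X in _ + dot _ X]/great_circle linearD !linearZ.
apply: (is_derive_eq H).
have c0 : c 0 = x := great_circle0 x w.
have c'0 : c' 0 = w := great_circle0 w (- x).
have E1 := dhext_radial XU x0.
have E0 : 'd s x (- x) = 0 by rewrite linearN E1 oppr0.
rewrite c0 c'0 sin0 cos0 E0.
have simp (a u v z : E) : dot (- x *m L) a + dot (w *m L) u + (dot (w *m L) (1 *: u + 0 *: 0) +
    dot (x *m L) (- 0 *: u + 1 *: v + (1 *: 0 + 0 *: z))) =
    - dot (x *m L) a + 2 * dot (w *m L) u + dot (x *m L) v.
  rewrite mulNmx !(dotDr, dotZr) dotNl !dot0r; ring.
exact: simp.
Qed.

Section AtPoint.
Variables x w1 w2 : E.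
Hypothesis F : frame x (s x) w1 w2.
Local Notation A := (dot ('d s x w1) w1).
Local Notation B := (dot ('d s x w1) w2).

(** [shear_free_identity] on the pairs from [w1], [w2] makes the symmetric part of [ds] on the
    normal plane a multiple of the identity; the components along [x] and [s x] vanish by the
    constraints on [s]. *)
Lemma dhext_frame : 'd s x w1 = A *: w1 + B *: w2 /\ 'd s x w2 = - B *: w1 + A *: w2.
Proof.
have [[xS h11 h22 h33] [h01 h02 h03 [h12 h13 h23]]] := frame_dot F.
have x0 := S3_neq0 xS.
have n1 : dot w1 w1 = 1 := h22. have n2 : dot w2 w2 = 1 := h33.
have I11 := shear_free_identity XU Xg Xlam w1 w1 xS.
have I22 := shear_free_identity XU Xg Xlam w2 w2 xS.
have I12 := shear_free_identity XU Xg Xlam w1 w2 xS.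
have x1 : dot w1 x = 0 by rewrite dotC.
have x2 : dot w2 x = 0 by rewrite dotC.
have s1 : dot w1 (s x) = 0 by rewrite dotC.
have s2 : dot w2 (s x) = 0 by rewrite dotC.
rewrite x1 s1 n1 !(mulr0, mul0r, addr0, subr0) mulr1 in I11.
rewrite x2 s2 n2 !(mulr0, mul0r, addr0, subr0) mulr1 in I22.
rewrite x1 s1 x2 s2 h23 !(mulr0, mul0r, addr0, subr0) in I12.
have e22 : dot ('d s x w2) w2 = A by lra.
have e21 : dot ('d s x w2) w1 = - B by lra.
have dx w : dot w (s x) = 0 -> dot ('d s x w) x = 0.
  by move=> ws; rewrite (dot_dhext XU)// dotC ws oppr0.
have dS w := dot_dhext_hext XU w x0.
split; rewrite [LHS](frame_expand F) dS dx// !scale0r !add0r//.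
by rewrite e21 e22.
Qed.

(** The normal components vanish by the Codazzi equation; the other two are forced by
    differentiating [<s, x> = 0] and [<s, s> = 1] twice. *)
Lemma d2s_trace : d2s X x w1 w1 + d2s X x w2 w2 =
  - 4 * A *: x + - 2 * (A ^+ 2 + B ^+ 2) *: s x.
Proof.
have [[xS h11 h22 h33] [h01 h02 h03 [h12 h13 h23]]] := frame_dot F.
have x0 := S3_neq0 xS; have [D1 D2] := dhext_frame.
have n1 : dot w1 w1 = 1 := h22. have n2 : dot w2 w2 = 1 := h33.
have x1 : dot w1 x = 0 by rewrite dotC.
have x2 : dot w2 x = 0 by rewrite dotC.
have s1 : dot w1 (s x) = 0 by rewrite dotC.
have s2 : dot w2 (s x) = 0 by rewrite dotC.
have h32 : dot w2 w1 = 0 by rewrite dotC.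
have e22 : dot ('d s x w2) w2 = A.
  by rewrite D2 dotDl !dotZl h23 n2 mulr0 mulr1 add0r.
have q1 : dot ('d s x w1) ('d s x w1) = A ^+ 2 + B ^+ 2.
  rewrite {2}D1 dotDr !dotZr; ring.
have q2 : dot ('d s x w2) ('d s x w2) = A ^+ 2 + B ^+ 2.
  rewrite D2 !(dotDl, dotDr, dotZl, dotZr) n1 n2 h23 h32; ring.
have T1 := d2s_trace_normal XU Xg slam Xlam xS h22 h33 h23 x1 x2 s1 s2.
have T2 := d2s_trace_normal XU Xg slam Xlam xS h33 h22 h32 x2 x1 s2 s1.
have TX : dot (d2s X x w1 w1 + d2s X x w2 w2) x = - 4 * A.
  apply: (etrans (dotDl _ _ _)).
  apply: (etrans (congr2 +%R (d2s_dot_pos XU w1 x0) (d2s_dot_pos XU w2 x0))).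
  by rewrite e22; ring.
have TS : dot (d2s X x w1 w1 + d2s X x w2 w2) (s x) = - 2 * (A ^+ 2 + B ^+ 2).
  apply: (etrans (dotDl _ _ _)).
  apply: (etrans (congr2 +%R (d2s_dot_hext XU w1 x0) (d2s_dot_hext XU w2 x0))).
  by rewrite q1 q2; ring.
move: T1 T2 TX TS; rewrite (addrC (d2s X x w2 w2)).
move: (d2s X x w1 w1 + d2s X x w2 w2) => S T1 T2 TX TS.
by rewrite [LHS](frame_expand F) T1 T2 TX TS !scale0r !addr0.
Qed.

(** In the frame, [L] has coordinates [p, r, u] with [p ^ 2 + r ^ 2 + u ^ 2 = 1]. The derivatives of
    [p] along [w1] and [w2] are [a r + (b - e) u] and [a u - (b - e) r], that is, [r + i u]
    multiplied by [a - i (b - e)], whose squared modulus is [k]. *)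
Lemma quad_laplacian e X0 Y0 : e ^+ 2 = 1 -> S3 X0 -> S3 Y0 -> dot X0 Y0 = 0 ->
  let L := dual_mx e X0 Y0 in let k := A ^+ 2 + (B - e) ^+ 2 in
  [/\ quad L x ^+ 2 <= 1,
    dquad L x w1 0 ^+ 2 + dquad L x w2 0 ^+ 2 = k * (1 - quad L x ^+ 2) &
    (- quad L x + 2 * dot (w1 *m L) ('d s x w1) + dot (x *m L) (d2s X x w1 w1)) +
    (- quad L x + 2 * dot (w2 *m L) ('d s x w2) + dot (x *m L) (d2s X x w2 w2))
    = - 2 * k * quad L x].
Proof.
move=> e2 XS YS XY L k.
have [P23 P13 P12 P1] := dual_mx_frame F e2 XS YS XY.
have anti a b : dot (a *m L) b = - dot (b *m L) a := dual_mx_anti e X0 Y0 a b.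
have diag a : dot (a *m L) a = 0 by have := anti a a; lra.
have [D1 D2] := dhext_frame; move: D1 D2 d2s_trace; rewrite /k !dquad0 {k}.
move: (A) (B) => a b.
move: ('d s x w1) ('d s x w2) (d2s X x w1 w1) (d2s X x w2 w2) => v1 v2 S1 S2 D1 D2 ES.
rewrite -/L -!/(quad L x) in P23 P13 P12 P1.
move: (ES) => ES'.
have {ES'} : dot (x *m L) S1 + dot (x *m L) S2 = - 2 * (a ^+ 2 + b ^+ 2) * quad L x.
  by rewrite -dotDr ES dotDr !dotZr diag mulr0 add0r.
rewrite {}D1 {}D2 !dotDr !dotZr (anti w1 (s x)) (anti w2 (s x)) -!/(quad L x).
rewrite !diag (anti w2 w1) P23 P12 P13 {ES}.
move: (dot (x *m L) S1) (dot (x *m L) S2) => T1 T2 ES.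
set p := quad L x in P1 ES *; set r := dot (x *m L) w1 in P1 *.
set u := dot (x *m L) w2 in P1 *.
split.
- by have := sqr_ge0 r; have := sqr_ge0 u; lra.
- have -> : 1 - p ^+ 2 = r ^+ 2 + u ^+ 2 by rewrite -P1; ring.
  transitivity ((a ^+ 2 + b ^+ 2 - 2 * b * e) * (r ^+ 2 + u ^+ 2) + e ^+ 2 * (r ^+ 2 + u ^+ 2)).
    by ring.
  by rewrite -mulrDl; congr (_ * _); ring.
transitivity (- 2 * (a ^+ 2 + b ^+ 2 - 2 * b * e + 1) * p + (T1 + T2 + 2 * (a ^+ 2 + b ^+ 2) * p)).
  by ring.
rewrite ES; transitivity (- 2 * (a ^+ 2 + b ^+ 2 - 2 * b * e + e ^+ 2) * p); last by ring.
by rewrite e2; ring.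
Qed.

End AtPoint.

(** A maximum at [x] imposes first and second order conditions along the great circles in directions
    [w1] and [w2], and [no_critical_maximum] refutes them. *)
Lemma barrier_not_maximal x e X0 Y0 (h : R) w1 w2 : frame x (s x) w1 w2 ->
  e ^+ 2 = 1 -> S3 X0 -> S3 Y0 -> dot X0 Y0 = 0 ->
  let p y := quad (dual_mx e X0 Y0) y in let q y := quad (dual_mx (- e) X0 Y0) y in
  0 < 1 - p x -> 0 < 1 + p x -> 0 < 1 - q x ->
  0 <= e * dot ('d s x w1) w2 ->
  (1 - p x) ^+ 2 = h * ((1 + p x) ^+ 2 * (1 - q x)) ->
  ~ (forall y, S3 y -> (1 - p y) ^+ 2 <= h * ((1 + p y) ^+ 2 * (1 - q y))).
Proof.
set L := dual_mx e X0 Y0; set L' := dual_mx (- e) X0 Y0.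
move=> F e2 XS YS XY p q P0 N0 Q0 eB Eh hmax.
have [[xS h11 h22 h33] [h01 h02 h03 [h12 h13 h23]]] := frame_dot F.
have ne2 : (- e) ^+ 2 = 1 by rewrite sqrrN.
have [_ Sa Sc] := quad_laplacian F e2 XS YS XY.
have [_ Sb Sd] := quad_laplacian F ne2 XS YS XY.
rewrite -/L -/(p x) in Sa Sc; rewrite -/L' -/(q x) in Sb Sd.
set A := dot ('d s x w1) w1 in Sa Sb Sc Sd; set B := dot ('d s x w1) w2 in Sa Sb Sc Sd eB.
have m0 : 0 < A ^+ 2 + (B - - e) ^+ 2 by exact: sum_sqr_gt0.
have curve w c d : S3 w -> dot x w = 0 ->
    is_derive (0 : R) 1 (dquad L x w) c -> is_derive (0 : R) 1 (dquad L' x w) d ->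
    let a := dquad L x w 0 in let b := dquad L' x w 0 in
    - 2 * (1 - p x) * a - h * (2 * (1 + p x) * a * (1 - q x) - (1 + p x) ^+ 2 * b) = 0 /\
    2 * a ^+ 2 - 2 * (1 - p x) * c - h * (2 * a ^+ 2 * (1 - q x)
    + 2 * (1 + p x) * c * (1 - q x) - 4 * (1 + p x) * a * b - (1 + p x) ^+ 2 * d) <= 0.
  move=> wS xw hdp hdq a b.
  have hp t := is_derive_quad L t xS wS xw.
  have hq t := is_derive_quad L' t xS wS xw.
  have g0 : great_circle x w 0 = x := great_circle0 x w.
  have kmax t : (1 - quad L (great_circle x w t)) * (1 - quad L (great_circle x w t))
      - h * ((1 + quad L (great_circle x w t)) * (1 + quad L (great_circle x w t)) *
        (1 - quad L' (great_circle x w t))) <=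
     (1 - quad L (great_circle x w 0)) * (1 - quad L (great_circle x w 0))
      - h * ((1 + quad L (great_circle x w 0)) * (1 + quad L (great_circle x w 0)) *
        (1 - quad L' (great_circle x w 0))).
    rewrite g0 -!expr2 -/(p x) -/(q x) [X in _ <= X - _]Eh subrr subr_le0.
    exact/hmax/great_circle_S3.
  have [E1 E2] := second_derivative_at_max
    (fun t => is_derive_barrier h (hp t) (hq t))
    (is_derive_barrier2 h (hp 0) (hq 0) hdp hdq) kmax.
  move: E1 E2; rewrite g0 -/(p x) -/(q x) -/a -/b => E1 E2; split=> //.
  by rewrite -[RHS]E1; ring.
have [F1 K1] := curve _ _ _ h22 h02 (is_derive_dquad L xS h22 h02) (is_derive_dquad L' xS h22 h02).
have [F2 K2] := curve _ _ _ h33 h03 (is_derive_dquad L xS h33 h03) (is_derive_dquad L' xS h33 h03).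
exact: (no_critical_maximum P0 N0 Q0 m0 Eh F1 F2 Sa Sb Sc Sd K1 K2).
Qed.

End Laplacian.

(** * Rigidity *)

Section Rigidity.
Variable R : realType.
Local Notation E := 'rV[R]_4.
Variable X : E -> E.
Hypothesis XU : unit_vector_field X.
Local Notation s := (hext X).
Implicit Types (x y v w : E) (t : R).

Lemma S3_compact : compact (@S3 R).
Proof.
apply: bounded_closed_compact.
  exists 1; split=> // M M1 x xS; apply: (le_trans _ (ltW M1)).
  by rewrite -(ler_pXn2r (ltn0Sn 1)) ?nnegrE// expr1n -[leRHS](xS : dot x x = 1) coord_sqr_le_dot.
have c : continuous (fun x : E => dot x x : R).
  by move=> x; apply: differentiable_continuous; exact: differentiable_dot.
by move/continuous_closedP : c => /(_ [set 1]); apply; exact: closed_eq.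
Qed.

Lemma quad_continuous (L : 'M[R]_4) y : y != 0 -> {for y, continuous (fun z => quad X L z : R)}.
Proof.
move=> y0; apply: differentiable_continuous; apply: differentiable_dot.
  exact: differentiable_mulmx.
exact: differentiable_hext.
Qed.

Lemma clamp_small (d m u : R) : u < d -> d <= m -> clamp d m u = d.
Proof. by move=> ud dm; rewrite /clamp max_l// ge_min (ltW ud). Qed.

(* The barrier (1 - p)^2 / ((1 + p)^2 (1 - q)) tends to 0 at points where q = 1,
   hence it attains its supremum although it is undefined there. *)
Lemma barrier_maximum (p q : E -> R) y0 :
  (forall y, S3 y -> {for y, continuous p}) -> (forall y, S3 y -> {for y, continuous q}) ->
  (forall y, S3 y -> p y <= 1) -> (forall y, S3 y -> -1 <= q y) ->
  (forall y, S3 y -> -1 < p y) -> (forall y, S3 y -> q y <= p y) ->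
  S3 y0 -> p y0 < 1 -> exists x h, [/\ S3 x, p x < 1,
    (1 - p x) ^+ 2 = h * ((1 + p x) ^+ 2 * (1 - q x)) &
    forall y, S3 y -> (1 - p y) ^+ 2 <= h * ((1 + p y) ^+ 2 * (1 - q y))].
Proof.
move=> cp cq p1 qN1 pN1 qp yS py0.
pose H d y := (1 - p y) ^+ 2 / ((1 + p y) ^+ 2 * clamp d 2 (1 - q y)).
have N0 y : S3 y -> 0 < 1 + p y by move=> /pN1; lra.
have Q2 y : S3 y -> 1 - q y <= 2 by move=> /qN1; lra.
pose h0 := (1 - p y0) ^+ 2 / ((1 + p y0) ^+ 2 * (1 - q y0)).
have q0 : 0 < 1 - q y0 by rewrite subr_gt0 (le_lt_trans (qp _ yS)).
have h00 : 0 < h0.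
  apply: divr_gt0; first by rewrite exprn_gt0// subr_gt0.
  by apply: mulr_gt0 => //; exact/exprn_gt0/N0.
(* The bound [1 - q y0] preserves the value [h0] at [y0]; the bound 1 gives [1 <= 1 + p] where the
   clamp acts, so that [H d < d] there; the bound [h0] then excludes a maximum at such points. *)
pose d := Num.min 1 (Num.min (1 - q y0) h0).
have d0 : 0 < d by rewrite !lt_min ltr01 q0 h00.
have d1 : d <= 1 by rewrite ge_min lexx.
have dq : d <= 1 - q y0 by rewrite !ge_min lexx orbT.
have dh : d <= h0 by rewrite !ge_min lexx !orbT.
have d2 : d <= 2 by rewrite (le_trans d1)// ler1n.
have c0 y : 0 < clamp d 2 (1 - q y) by have /andP[/(lt_le_trans d0)] := clampP (1 - q y) d2.
have cH : {within @S3 R, continuous (H d)}.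
  apply: continuous_in_subspaceT => y; rewrite inE => yS'.
  have c1 : {for y, continuous (fun=> 1 : R)} by exact: cst_continuous.
  have cQ : {for y, continuous (fun z => 1 - q z)} by exact: cvgB c1 (cq y yS').
  have cc : {for y, continuous (fun z => clamp d 2 (1 - q z))}.
    apply: (@continuous_comp _ _ _ (fun z => 1 - q z) (clamp d 2)) => //.
    exact: clamp_continuous.
  have cP : {for y, continuous (fun z => 1 - p z)} by exact: cvgB c1 (cp y yS').
  have cN : {for y, continuous (fun z => 1 + p z)} by exact: cvgD c1 (cp y yS').
  have den0 : (1 + p y) * (1 + p y) * clamp d 2 (1 - q y) != 0.
    by rewrite -expr2; exact: lt0r_neq0 (mulr_gt0 (exprn_gt0 2 (N0 y yS')) (c0 y)).
  have h1 : {for y, continuous (fun z => (1 - p z) * (1 - p z))} by apply: continuousM.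
  have h2 : {for y, continuous (fun z => (1 + p z) * (1 + p z))} by apply: continuousM.
  have h3 : {for y, continuous (fun z => (1 + p z) * (1 + p z) * clamp d 2 (1 - q z))}.
    by apply: continuousM.
  have h4 : {for y, continuous (fun z => ((1 + p z) * (1 + p z) * clamp d 2 (1 - q z))^-1)}.
    by apply: continuousV.
  have -> : H d = (fun z => (1 - p z) * (1 - p z) *
      ((1 + p z) * (1 + p z) * clamp d 2 (1 - q z))^-1).
    by rewrite funeqE => z; rewrite /H !expr2.
  exact: continuousM h1 h4.
have [|x xS xmax] := @EVT_max_rV R _ (H d) (@S3 R) _ S3_compact cH.
  by exists y0.
have {}xS : S3 x by rewrite inE in xS.
have {}xmax y : S3 y -> H d y <= H d x by move=> yS'; apply: xmax; rewrite inE.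
have Hy0 : H d y0 = h0 by rewrite /H clamp_id// dq Q2.
have hx : h0 <= H d x by rewrite -Hy0 xmax.
have Nq y : S3 y -> 1 - q y < d -> 1 <= 1 + p y.
  by move=> /qp h1 h2; move: h1 h2 d1; lra.
have PQ y : S3 y -> 0 <= 1 - p y <= 1 - q y.
  by move=> yS'; have := p1 _ yS'; have := qp _ yS'; lra.
have xq : d <= 1 - q x.
  rewrite leNgt; apply/negP => qd; have := le_trans dh hx.
  rewrite leNgt => /negP; apply; rewrite /H clamp_small//.
  have /andP[P0 PQx] := PQ x xS.
  have N1 := Nq x xS qd.
  rewrite ltr_pdivrMr; last by apply: mulr_gt0 => //; exact/exprn_gt0/N0.
  apply: (@lt_le_trans _ _ (d ^+ 2)).
    by rewrite ltr_pXn2r ?nnegrE ?(ltW d0)// (le_lt_trans PQx).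
  rewrite mulrCA -expr2 ler_peMl ?sqr_ge0//.
  exact: exprn_ege1.
have EHx : H d x = (1 - p x) ^+ 2 / ((1 + p x) ^+ 2 * (1 - q x)).
  by rewrite /H clamp_id// xq Q2.
have xQ : 0 < 1 - q x := lt_le_trans d0 xq.
have xN : 0 < (1 + p x) ^+ 2 * (1 - q x).
  by apply: mulr_gt0 => //; exact/exprn_gt0/N0.
have Ex : (1 - p x) ^+ 2 = H d x * ((1 + p x) ^+ 2 * (1 - q x)).
  by rewrite EHx divfK// gt_eqF.
exists x, (H d x); split=> //.
  rewrite lt_neqAle p1// andbT; apply/eqP => px.
  have : 0 < (1 - p x) ^+ 2 by rewrite Ex mulr_gt0// (lt_le_trans h00).
  by rewrite px subrr expr2 mulr0 ltxx.
move=> y yS'; have [yd|yd] := leP d (1 - q y).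
  have := xmax y yS'; rewrite {1}/H clamp_id ?yd ?Q2// ler_pdivrMr//.
  by apply: mulr_gt0; [exact/exprn_gt0/N0 | exact: lt_le_trans d0 yd].
have /andP[P0 PQy] := PQ y yS'; have N1 := Nq y yS' yd.
have Q0 : 0 <= 1 - q y := le_trans P0 PQy.
(* Where the clamp acts, [(1 - p)^2 <= (1 - q)^2 <= d (1 - q)], and [d <= h0 <= H d x]. *)
apply: (@le_trans _ _ ((1 - q y) * (1 - q y))); first by rewrite expr2 ler_pM.
rewrite mulrA; apply: ler_wpM2r => //.
apply: (@le_trans _ _ (H d x)); first by rewrite (le_trans (ltW yd))// (le_trans dh).
rewrite ler_peMr ?(le_trans (ltW h00))//.
exact: exprn_ege1.
Qed.

Lemma pole_S3 : S3 (delta_mx ord0 (inord 0) : E).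
Proof. by rewrite /S3/= dot_delta mxE !eqxx. Qed.

(** On the sphere [L] acts as [s], so in the orthonormal basis [X0, s X0, w, s w] it becomes the
    matrix of the canonical Hopf field. By [dual_mxE] this basis has orientation [e], so the
    isometry may reverse orientation. *)
Lemma hopf_of_dual_mx e X0 : e ^+ 2 = 1 -> S3 X0 ->
  (forall x, S3 x -> s (s x) = - x) ->
  (forall y, S3 y -> X y = y *m dual_mx e X0 (s X0)) -> hopf_vector_field X.
Proof.
move=> e2 xS ss XL; set L := dual_mx e X0 (s X0) in XL.
have sL y : S3 y -> y *m L = s y by move=> yS; rewrite hext_S3// XL.
have x0 := S3_neq0 xS; have sS := hext_unit XU xS.
have xs := dot_x_hext XU xS.
have [w [w2 [F v1]]] := frame_completion xS sS xs.
have [[_ _ wS _] [_ h02 _ [h12 _ _]]] := frame_dot (conj F v1).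
have swS := hext_unit XU wS.
have anti a b : dot (a *m L) b = - dot (b *m L) a := dual_mx_anti e X0 (s X0) a b.
have QQ : rows4 X0 (s X0) w (s w) *m (rows4 X0 (s X0) w (s w))^T = 1%:M.
  apply: rows4_orthonormal => //.
  - by rewrite dotC -(sL _ wS) anti sL// dotC -[RHS]oppr0 -h12 dotC.
  - by rewrite dotC -(sL _ wS) anti sL// ss// dotNl opprK.
  - exact: dot_x_hext.
split=> //; exists (rows4 X0 (s X0) w (s w)); split=> //.
set Q := rows4 _ _ _ _ in QQ *.
have Qu : Q \in unitmx by case: (mulmx1_unit QQ).
move=> y yS; rewrite XL// /Defs.pushforward canonical_hopfE -mulmxA.
have -> : hopf_mx R *m Q = Q *m L.
  rewrite /Q rows4_mul !sL// !ss//.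
  apply/matrixP => i j; rewrite mxE sum4; move: i; apply: ord4P;
    rewrite !mxE !inordK//= ?mxE; ring.
by rewrite mulmxA mulmxKV.
Qed.

Hypothesis Xsfg : shear_free_geodesic X.

Lemma shear_free_geodesic_is_hopf : hopf_vector_field X.
Proof.
have [[lam [slam Xlam]] Xgeo] := Xsfg.
have Xg x : S3 x -> 'd s x (s x) = - x by exact: geodesic_field.
pose x0 : E := delta_mx ord0 (inord 0).
have xS : S3 x0 := pole_S3.
have sS := hext_unit XU xS; have xs := dot_x_hext XU xS.
pose V y := vol y (s y) x0 (s x0).
have [u1 [u2 F0]] := frame_completion xS sS xs.
have onleaf y A B : S3 y -> y = A *: x0 + B *: s x0 ->
    A ^+ 2 + B ^+ 2 = 1 /\ s y = - B *: x0 + A *: s x0.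
  move=> yS Ey; have AB : A ^+ 2 + B ^+ 2 = 1 by rewrite -(dot_leaf XU A B xS) -Ey.
  by split=> //; rewrite Ey hext_leaf.
have Vleaf y A B : S3 y -> y = A *: x0 + B *: s x0 -> V y = 0.
  move=> yS Ey; have [_ Es] := onleaf _ _ _ yS Ey.
  by rewrite /V Es {1}Ey volE /minor2 !mxE; ring.
have off y : S3 y -> V y != 0 -> forall A B, y <> A *: x0 + B *: s x0.
  by move=> yS /eqP Vy A B /(Vleaf _ _ _ yS).
have u1S : S3 u1 by have [[_ _ h _] _] := frame_dot F0.
have Vu1 : V u1 != 0.
  apply/eqP => /(vol0_same_leaf XU Xg xS u1S)[A [B Eu]].
  have [[_ _ h22 _] [_ h02 _ [h12 _ _]]] := frame_dot F0.
  move: (oner_neq0 R); rewrite -(u1S : dot u1 u1 = 1) {1}Eu dotDl !dotZl h02 h12.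
  by rewrite !mulr0 addr0 eqxx.
(* This sign makes [e * V] positive off the leaf of [x0], whence [q <= p]. *)
pose e : R := if 0 < V u1 then 1 else -1.
have e2 : e ^+ 2 = 1 by rewrite /e; case: ifP => _; rewrite ?expr1n// sqrrN expr1n.
have ne2 : (- e) ^+ 2 = 1 by rewrite sqrrN.
have eV y : S3 y -> V y != 0 -> 0 < e * V y.
  move=> yS Vy.
  have := vol_same_sign XU Xg F0 yS u1S (off _ yS Vy) (off _ u1S Vu1).
  rewrite -/(V y) -/(V u1) /e; case: (ltP 0 (V u1)) => V1.
    by rewrite pmulr_lgt0// mul1r.
  have V1' : V u1 < 0 by rewrite lt_neqAle Vu1 V1.
  by rewrite nmulr_lgt0// mulN1r oppr_gt0.
pose p y := quad X (dual_mx e x0 (s x0)) y.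
pose q y := quad X (dual_mx (- e) x0 (s x0)) y.
have pq y : p y - q y = 2 * (e * V y).
  by rewrite /p /q /quad !dual_mxE /V; ring.
have frame_at y : S3 y -> exists w1 w2, frame y (s y) w1 w2.
  move=> yS; apply: frame_completion => //; first exact: hext_unit.
  exact: dot_x_hext.
have p2 y : S3 y -> p y ^+ 2 <= 1.
  move=> yS; have [w1 [w2 F]] := frame_at y yS.
  by have [] := quad_laplacian XU Xg slam Xlam F e2 xS sS xs.
have q2 y : S3 y -> q y ^+ 2 <= 1.
  move=> yS; have [w1 [w2 F]] := frame_at y yS.
  by have [] := quad_laplacian XU Xg slam Xlam F ne2 xS sS xs.
have sqr_le1 (a : R) : a ^+ 2 <= 1 -> -1 <= a <= 1.
  by move=> a2; rewrite -ler_norml -(ler_pXn2r (ltn0Sn 1)) ?nnegrE// expr1n real_normK ?num_real.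
have pleaf y : S3 y -> V y = 0 -> p y = 1.
  move=> yS /(vol0_same_leaf XU Xg xS yS)[A [B Ey]].
  have [AB Es] := onleaf _ _ _ yS Ey.
  have V0 := Vleaf _ _ _ yS Ey.
  have xx : dot x0 x0 = 1 := xS; have ss : dot (s x0) (s x0) = 1 := sS.
  have sx : dot (s x0) x0 = 0 by rewrite dotC.
  rewrite /p /quad dual_mxE -/(V y) V0 Es Ey !(dotDl, dotDr, dotZl, dotZr) xx ss sx xs.
  by transitivity (A ^+ 2 + B ^+ 2); [ring | exact: AB].
have qp y : S3 y -> q y <= p y.
  move=> yS; rewrite -subr_ge0 pq; have [->|/(eV y yS) h] := eqVneq (V y) 0.
    by rewrite !mulr0.
  by rewrite mulr_ge0// ltW.
(* The strict inequality keeps [1 + p] invertible: off the leaf [p > q >= - 1], on it [p = 1]. *)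
have pN1 y : S3 y -> -1 < p y.
  move=> yS; have [/(pleaf y yS) ->|/(eV y yS) h] := eqVneq (V y) 0.
    by rewrite (lt_trans _ ltr01)// oppr_lt0.
  have /andP[q1 _] := sqr_le1 _ (q2 y yS).
  by apply: (le_lt_trans q1); rewrite -subr_gt0 pq mulr_gt0.
have p1 y : S3 y -> p y = 1.
  move=> yS; apply/eqP; rewrite eq_le; have /andP[_ ->] := sqr_le1 _ (p2 y yS).
  rewrite /= leNgt; apply/negP => py.
  have [||z zS|z zS|x [h [yxS px Ex hx]]] := @barrier_maximum p q y _ _ _ _ pN1 qp yS py.
  - by move=> z zS; exact: quad_continuous (S3_neq0 zS).
  - by move=> z zS; exact: quad_continuous (S3_neq0 zS).
  - by have /andP[] := sqr_le1 _ (p2 z zS).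
  - by have /andP[] := sqr_le1 _ (q2 z zS).
  have Vx : V x != 0 by apply/eqP => /(pleaf x yxS) px1; rewrite px1 ltxx in px.
  have [w1 [w2 F]] := frame_at x yxS.
  (* Exchanging the two leaves makes [x] the base point, so that the twist at [x] is compared with
     the volume at [x0]. *)
  have Vx' : vol x0 (s x0) x (s x) = V x by rewrite vol_swap.
  have offx A B : x0 <> A *: x + B *: s x.
    move=> Ex0; have AB : A ^+ 2 + B ^+ 2 = 1 by rewrite -(dot_leaf XU A B yxS) -Ex0.
    have Es := hext_leaf XU Xg yxS AB; rewrite -Ex0 in Es.
    move/eqP : Vx; apply; rewrite -Vx' Es {1}Ex0 volE /minor2 !mxE; ring.
  have := vol_sign_twist XU Xg F xS offx; rewrite Vx' => VB.
  have eB : 0 <= e * dot ('d s x w1) w2.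
    have := eV x yxS Vx => eVx.
    rewrite -(pmulr_rge0 _ eVx) mulrACA -expr2 e2 mul1r//.
  apply: (barrier_not_maximal XU Xg slam Xlam F e2 xS sS xs _ _ _ eB Ex hx).
  - by rewrite subr_gt0.
  - by have := pN1 x yxS; rewrite -subr_gt0 opprK addrC.
  - by rewrite subr_gt0 (le_lt_trans (qp x yxS)).
apply: (hopf_of_dual_mx e2 xS).
  move=> x yS; have := hext_leaf XU Xg yS (_ : 0 ^+ 2 + 1 ^+ 2 = 1).
  by rewrite !scale0r scale1r add0r scaleN1r addr0; apply; rewrite expr0n/= add0r expr1n.
move=> y yS; set L := dual_mx e x0 (s x0).
have [w1 [w2 F]] := frame_at y yS.
have [_ _ _ P1] := dual_mx_frame F e2 xS sS xs.
(* [y *m L] and [s y] are unit vectors with inner product [p y = 1], hence equal. *)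
have nL : dot (y *m L) (y *m L) = 1.
  have d0 : dot (y *m L) y = 0.
    have : dot (y *m L) y = - dot (y *m L) y := dual_mx_anti e x0 (s x0) y y.
    by move/eqP; rewrite -addr_eq0 -mulr2n mulrn_eq0/= => /eqP.
  by rewrite (frame_parseval F) d0 mulr0 add0r -P1 !expr2.
have sy1 : dot (s y) (s y) = 1 := hext_unit XU yS.
have ps : dot (y *m L) (s y) = 1 := p1 y yS.
apply/eqP; rewrite -(hext_S3 X yS) -subr_eq0 -dot_eq0 dotBl !dotBr nL sy1 ps (dotC (s y)) ps.
by rewrite !subrr.
Qed.

End Rigidity.

Theorem mainTheorem4 (R : realType) (sigma : 'rV[R]_4 -> 'rV[R]_4)
    (sigma_unit : unit_vector_field sigma) :
  shear_free_geodesic sigma <-> hopf_vector_field sigma.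
Proof.
split; first exact: shear_free_geodesic_is_hopf.
exact: hopf_shear_free_geodesic.
Qed.
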